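(* Let $n\ge1$ and $d>2$ be integers and let $X\subset\mathbb CP^n$ be a smooth hypersurface of degree $d$. Then the order of the subgroup of $\mathrm{PGL}_{n+1}(\mathbb C)$ consisting of the transformations preserving $X$ divides $$\frac{1}{n+1}\prod_{i=0}^{n-1}\frac{1}{\binom{n+1}{i}}\big((-1)^{n-i}+(d-1)^{n-i+1}\big)\,\mathrm{LCM}\Big(\tbinom{n+1}{i}(d-1)^i,\,(n+1)(d-1)^n\Big).$$
   Context: $\mathrm{LCM}$ denotes the least common multiple and $\binom{n+1}{i}$ the binomial coefficient. *)

(* Defs.v *)
From mathcomp Require Import all_boot all_algebra.
From mathcomp Require Import Rstruct.
From mathcomp.real_closed Require Import complex.
From mathcomp Require Import mpoly.
Set Implicit Arguments. Unset Strict Implicit. Unset Printing Implicit Defensive.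
Import GRing.Theory.
Local Open Scope ring_scope.

Notation CC := (complex Rdefinitions.R).

(* A point of C^m is nonzero (so that it represents a point of projective space). *)
Definition nonzero_pt (m : nat) (x : 'I_m -> CC) : Prop := exists i, x i != 0.

Definition mx_act (m : nat) (A : 'M[CC]_m) (x : 'I_m -> CC) : 'I_m -> CC :=
  fun i => \sum_(j < m) A i j * x j.

Definition smooth_hypersurface (m d : nat) (F : {mpoly CC[m]}) : Prop :=
  [/\ F != 0, F \is d.-homog &
      forall x : 'I_m -> CC, nonzero_pt x -> F.@[x] = 0 ->
        exists i : 'I_m, (mderiv i F).@[x] != 0].

(* The projective transformation induced by the invertible matrix A preserves
   the hypersurface X = {[x] | F(x) = 0} (set-theoretically: A X = X). *)
Definition preserves (m : nat) (A : 'M[CC]_m) (F : {mpoly CC[m]}) : Prop :=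
  forall x : 'I_m -> CC, nonzero_pt x -> (F.@[x] = 0 <-> F.@[mx_act A x] = 0).

(* Two matrices define the same element of PGL_m(C). *)
Definition proportional (m : nat) (A B : 'M[CC]_m) : Prop :=
  exists c : CC, c != 0 /\ A = c *: B.

Definition bound (n d : nat) : rat :=
  (n.+1%:R)^-1 *
  \prod_(0 <= i < n)
     (('C(n.+1, i))%:R^-1 *
      ((-1) ^+ (n - i) + ((d - 1) ^ (n - i + 1))%:R) *
      (lcmn ('C(n.+1, i) * (d - 1) ^ i) (n.+1 * (d - 1) ^ n))%:R).

(* Main.v *)
Require Import Defs.
From HB Require Import structures.
From mathcomp Require Import all_boot all_order all_algebra.
From mathcomp Require Import Rstruct separable.
From mathcomp.real_closed Require Import complex.
From mathcomp Require Import zify ring.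
From mathcomp Require Import mpoly.
From Stdlib Require Import Classical ClassicalEpsilon.
Set Implicit Arguments. Unset Strict Implicit. Unset Printing Implicit Defensive.
Import Order.TTheory GRing.Theory Num.Theory.
Local Open Scope ring_scope.

(** Write [m = n + 1], [e = d - 1] and [q = - e].  Let [G] be the group of the linear maps
    [A] with [F o A = F]; it is a central extension of the group of the statement by the
    [d]-th roots of unity, so it is enough that [#|G|] divides
    [|GL_m(q)| = prod_(j < m) (q^m - q^j)].

    - A transformation preserving the zero set multiplies [F] by a scalar, because [F] is
      separable on a generic line through a given point outside the hypersurface.
    - If [A x = z x] then [grad F x] is a left eigenvector of [A] for [z^-e].  Hence the
      eigenvalues of [A] in [G] are roots of unity of bounded order.  [G] contains no
      unipotent [u <> 1], since [grad F (u^s x) = grad F x u^-s] has different degrees in [s]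
      on the two sides; so [G] has finite exponent and is finite.
    - [r < m] forms in [m] variables have a common nontrivial zero, so the same eigenvector
      argument shows that the multiplicity of [z] is at most that of [z^-e].  Therefore
      [P_A(t) = det (1 - t^e A) / det (1 - t A^-1)] is a polynomial in [t].
    - The coefficients of [P_A] are virtual characters of [G] and
      [P_A(1) = (-1)^m det A q^(dim ker (A - 1))], so [q^(dim ker (A - 1))] is a virtual
      character, and so is [prod_(j < m) (q^(dim ker (A - 1)) - q^j)].  The latter vanishes
      for [A <> 1], so its value at [1] is a multiple of [#|G|]. *)

(** * Graded ideals and common zeros of forms *)

Section Homogeneous.
Variables (n : nat) (R : comNzRingType).
Implicit Types p q : {mpoly R[n]}.
Local Notation pih := (pihomog mdeg).

Lemma pihomogMr d k p q : q \is k.-homog ->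
  pih d (p * q) = if (k <= d)%N then pih (d - k) p * q else 0.
Proof.
move=> hq; have [N hN] : exists N, (msize p <= N)%N /\ (d < N)%N.
  by exists (maxn (msize p) d.+1); rewrite leq_maxl leq_maxr.
case: hN => hN dN.
have hom i : pih i p * q \is (i + k).-homog by rewrite dhomogM ?pihomogP.
rewrite {1}(pihomog_partitionE hN) mulr_suml raddf_sum /=.
case: leqP => kd; last first.
  apply: big1 => i _; rewrite (pihomog_ne0 _ (hom i)) //.
  by rewrite neq_ltn (leq_trans kd) ?orbT // leq_addl.
have lt : (d - k < N)%N by rewrite (leq_ltn_trans _ dN) ?leq_subr.
have := pihomog_dE (hom (d - k)%N); rewrite subnK // => hE.
rewrite (bigD1 (Ordinal lt)) //= hE big1 ?addr0 // => i ne.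
rewrite (pihomog_ne0 _ (hom i)) //.
apply: contra ne => /eqP e; apply/eqP/val_inj => /=.
by rewrite -e addnK.
Qed.

Lemma pihomog_ge d p : (msize p <= d)%N -> pih d p = 0.
Proof.
move=> h; rewrite (pihomogE mdeg) big1_seq // => m /andP[/eqP e] /msize_mdeg_lt.
by rewrite e ltnNge h.
Qed.

End Homogeneous.

Section Ideals.
Variables (n : nat) (R : comNzRingType).
Local Notation S := {mpoly R[n]}.
Local Notation pih := (pihomog mdeg).

Definition is_ideal (I : S -> Prop) :=
  [/\ I 0, forall p q, I p -> I q -> I (p + q) & forall p q, I q -> I (p * q)].

Definition is_graded (I : S -> Prop) := forall d p, I p -> I (pih d p).

Definition adjoin (I : S -> Prop) (f : S) : S -> Prop := fun p => exists q, I (p - q * f).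

Section Closure.
Variable I : S -> Prop.
Hypothesis idI : is_ideal I.

Lemma ideal0 : I 0. Proof. by case: idI. Qed.
Lemma idealD p q : I p -> I q -> I (p + q). Proof. by case: idI => _ h _; apply: h. Qed.
Lemma idealM p q : I q -> I (p * q). Proof. by case: idI => _ _; apply. Qed.
Lemma idealMr p q : I p -> I (p * q). Proof. by rewrite mulrC; apply: idealM. Qed.
Lemma idealN p : I p -> I (- p). Proof. by rewrite -mulN1r; apply: idealM. Qed.
Lemma idealB p q : I p -> I q -> I (p - q).
Proof. by move=> ip iq; apply: idealD => //; apply: idealN. Qed.
Lemma idealZ c p : I p -> I (c *: p). Proof. by rewrite -mul_mpolyC; apply: idealM. Qed.
Lemma ideal_sum (J : Type) (r : seq J) (P : pred J) (G : J -> S) :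
  (forall i, P i -> I (G i)) -> I (\sum_(i <- r | P i) G i).
Proof. by move=> h; elim/big_ind: _ => //; [exact: ideal0 | exact: idealD]. Qed.

Lemma ideal_congr p q : I (p - q) -> I q -> I p.
Proof. by move=> h1 h2; rewrite -(subrK q p); apply: idealD. Qed.

Lemma ideal_congr_trans q p r : I (p - q) -> I (q - r) -> I (p - r).
Proof. by move=> h1 h2; rewrite -(subrKA q); apply: idealD. Qed.

Lemma adjoin_ideal f : is_ideal (adjoin I f).
Proof.
split.
- by exists 0; rewrite mul0r subrr; apply: ideal0.
- move=> p q [a ha] [b hb]; exists (a + b).
  by rewrite mulrDl opprD addrACA; apply: idealD.
- move=> p q [b hb]; exists (p * b); rewrite -mulrA -mulrBr; exact: idealM.
Qed.

Lemma sub_adjoin f p : I p -> adjoin I f p.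
Proof. by move=> h; exists 0; rewrite mul0r subr0. Qed.

Lemma mem_adjoin f : adjoin I f f.
Proof. by exists 1; rewrite mul1r subrr; apply: ideal0. Qed.

Lemma adjoin_graded k f : is_graded I -> f \is k.-homog -> is_graded (adjoin I f).
Proof.
move=> gI hf d p [q hq]; have := gI d _ hq; rewrite raddfB /= (pihomogMr _ _ hf).
case: ifP => _ h; first by exists (pih (d - k) q).
by exists 0; rewrite mul0r.
Qed.

End Closure.
End Ideals.

Lemma mpoly_ring_ind (n : nat) (R : comNzRingType) (P : {mpoly R[n]} -> Prop) :
  (forall c, P c%:MP) -> (forall i, P 'X_i) ->
  (forall p q, P p -> P q -> P (p + q)) -> (forall p q, P p -> P q -> P (p * q)) ->
  forall p, P p.
Proof.
move=> hC hX hD hM; elim/mpolyind => [|c m p _ _ hp]; first by rewrite -mpolyC0.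
apply: (hD) => //; rewrite -mul_mpolyC; apply: (hM) => //; rewrite mpolyXE_id.
elim/big_ind: _ => [|p1 p2|i _]; [by rewrite -mpolyC1|exact: hM|].
by elim: (m i) => [|k IH]; rewrite ?expr0 -?mpolyC1 // exprS; apply: hM.
Qed.

(** * A graded Nullstellensatz *)

Section Nullstellensatz.
Variables (n : nat) (K : closedFieldType).
Local Notation S := {mpoly K[n]}.
Local Notation pih := (pihomog mdeg).

(** The morphism [q |-> q('X_i)]; a nonzero [q] with [pvar i q] in [J] witnesses that ['X_i] is
    algebraic modulo [J]. *)
Definition pvar (i : 'I_n) : {poly K} -> S := horner_morph (fun a => mulrC 'X_i (mpolyC n a)).
HB.instance Definition _ i := GRing.RMorphism.on (pvar i).

Lemma pvarX i : pvar i 'X = 'X_i.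
Proof. exact: horner_morphX. Qed.

Lemma pvarC i c : pvar i c%:P = c%:MP.
Proof. exact: horner_morphC. Qed.

(** If every ['X_i - z] were invertible modulo [J], then so would be [q('X_i)], a constant times a
    product of such factors, and [1] would lie in [J]. *)
Lemma split_proper (J : S -> Prop) i q : is_ideal J -> ~ J 1 -> q != 0 -> J (pvar i q) ->
  exists z : K, ~ adjoin J ('X_i - z%:MP) 1.
Proof.
move=> idJ nJ1 qn0 Jq; apply: NNPP => h.
have {}h z : adjoin J ('X_i - z%:MP) 1.
  by apply: NNPP => hz; apply: h; exists z.
have cancel r w : J (pvar i (\prod_(z <- r) ('X - z%:P)) * w) -> J w.
  elim: r w => [|z r IH] w; first by rewrite big_nil rmorph1 mul1r.
  rewrite big_cons rmorphM /= -mulrA mulrCA => /IH; rewrite rmorphB /= pvarX pvarC => hJ.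
  have [a ha] := h z.
  have := idealD idJ (idealM idJ w ha) (idealM idJ a hJ).
  by rewrite mulrBr mulr1 (mulrA a _ w) (mulrC _ w) subrK.
have [r e] := closed_field_poly_normal q.
apply: nJ1; apply: (cancel r); rewrite mulr1.
have -> : pvar i (\prod_(z <- r) ('X - z%:P)) = (lead_coef q)^-1%:MP * pvar i q.
  rewrite {2}e -mul_polyC rmorphM /= pvarC mulrA -mpolyCM mulVf ?lead_coef_eq0 //.
  by rewrite mpolyC1 mul1r.
exact: idealM.
Qed.

(** Adjoining a suitable ['X_i - z_i] for each variable in turn keeps the ideal proper. Modulo the
    final ideal [J'] every [p] is congruent to the constant [p(y)], which must vanish when [p] is in
    [J]. *)
Lemma proper_ideal_point (J : S -> Prop) : is_ideal J -> ~ J 1 ->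
  (forall i, exists2 q, q != 0 & J (pvar i q)) ->
  exists y : 'I_n -> K, forall p, J p -> p.@[y] = 0.
Proof.
move=> idJ nJ1 alg.
have [J' [idJ' nJ'1 sub hz]] : exists J', [/\ is_ideal J', ~ J' 1, (forall p, J p -> J' p) &
    forall i, i \in enum 'I_n -> exists z : K, J' ('X_i - z%:MP)].
  elim: (enum 'I_n) => [|i s [J' [idJ' nJ'1 sub hz]]]; first by exists J.
  have [q qn0 Jq] := alg i.
  have [z hzi] := split_proper idJ' nJ'1 qn0 (sub _ Jq).
  exists (adjoin J' ('X_i - z%:MP)); split => //; first exact: adjoin_ideal.
    by move=> p /sub; apply: sub_adjoin.
  move=> k; rewrite inE => /orP[/eqP->|/hz[w hw]]; last by exists w; apply: sub_adjoin.
  by exists z; apply: mem_adjoin.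
have [y hy] : exists y : 'I_n -> K, forall i, J' ('X_i - (y i)%:MP).
  apply: (@fin_all_exists _ (fun=> K) (fun i z => J' ('X_i - z%:MP))) => i.
  by apply: hz; rewrite mem_enum.
exists y => p /sub Jp.
have cong : J' (p - p.@[y]%:MP).
  elim/mpoly_ring_ind: p {Jp} => [c|i|p q hp hq|p q hp hq].
  - by rewrite mevalC subrr; apply: ideal0.
  - by rewrite mevalXU.
  - by rewrite mevalD mpolyCD opprD addrACA; apply: idealD.
  - rewrite mevalM mpolyCM -(subrKA (p.@[y]%:MP * q)) -mulrBl -mulrBr.
    by apply: idealD => //; [apply: idealMr | apply: idealM].
have := idealB idJ' Jp cong; rewrite subKr => hc.
apply/eqP; apply/negP => /negP ne; apply: nJ'1.
by rewrite -mpolyC1 -(mulVf ne) mpolyCM; apply: idealM.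
Qed.

(* The ideal [J = I + (X_j - 1)] has finite codimension, so the variables are algebraic
   modulo [J] and [J] has a zero, which is a zero of [I] with [y_j = 1], unless [1] is in
   [J]; in that case, reading [1 = b (X_j - 1)] modulo [I] degree by degree gives
   [b_t = - X_j^t], hence a power of [X_j] is in [I]. *)
Lemma nullstellensatz_step (I : S -> Prop) (j : 'I_n) D :
  is_ideal I -> is_graded I ->
  (forall y : 'I_n -> K, (exists i, y i != 0) -> exists2 p, I p & p.@[y] != 0) ->
  (forall m, (D <= mdeg m)%N -> adjoin I 'X_j 'X_[m]) ->
  exists D', forall m, (D' <= mdeg m)%N -> I 'X_[m].
Proof.
move=> idI gI nz hD.
(* Raising [D] by one makes it positive, so that degree [0] is always below [D] in [redJ]. *)
have {}hD m : (D.+1 <= mdeg m)%N -> adjoin I 'X_j 'X_[m] by move/ltnW; apply: hD.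
move: D.+1 (ltn0Sn D) hD => {}D D0 hD.
have Xj1 : 'X_j \is [in K[n], 1.-homog] by rewrite dhomogX /= mdeg1.
(* In degree at least [D], a form is modulo [I] the product of ['X_j] and a form of degree one
   less. *)
have redI t p : (D <= t)%N -> p \is t.-homog ->
    exists2 q, q \is t.-1.-homog & I (p - q * 'X_j).
  move=> Dt hp.
  have [q hq] : adjoin I 'X_j p.
    rewrite [p]mpolyE big_seq; apply: ideal_sum; first exact: adjoin_ideal.
    move=> m hm; apply: idealZ; first exact: adjoin_ideal.
    by apply: hD; rewrite (dhomog_mf hp hm).
  have := gI t _ hq; rewrite raddfB /= (pihomog_dE hp) (pihomogMr _ _ Xj1).
  case: t {Dt hp} => [|t] /=; rewrite ?subr0 => h; first by exists 0; rewrite ?mul0r ?subr0 // dhomog0.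
  by exists (pih (t.+1 - 1) q) => //; rewrite subn1 pihomogP.
pose J := adjoin I ('X_j - 1).
have idJ : is_ideal J by apply: adjoin_ideal.
have [J1|nJ1] := classic (J 1); last first.
  (* Modulo [J] the factor ['X_j] is [1], so [redI] lowers degrees until only monomials of degree
     below [D] remain. *)
  have redJ p : exists c : 'X_{1..n < D} -> K, J (p - \sum_m c m *: 'X_[m]).
    rewrite (pihomog_partitionE (leqnn (msize p))).
    elim/big_ind: _ => [|u v [c hc] [d hd]|i _].
    - by exists (fun=> 0); rewrite big1 ?subr0 => [|m _]; rewrite ?scale0r //; apply: ideal0.
    - exists (fun m => c m + d m).
      have -> : \sum_m (c m + d m) *: 'X_[m] = \sum_m c m *: 'X_[m] + \sum_m d m *: 'X_[m] :> S.
        by rewrite -big_split; apply: eq_bigr => m _; rewrite scalerDl.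
      by rewrite opprD addrACA; apply: idealD.
    - move: (nat_of_ord i) (pih i p) (pihomogP mdeg i p) => t {i}.
      elim/ltn_ind: t => t IH u hu; have [lt|ge] := ltnP t D.
        exists (fun m => u@_m); rewrite -mpolywE ?subrr; first exact: ideal0.
        rewrite msizeE big_seq; apply/bigmax_leqP_seq => m _ hm.
        by rewrite (dhomog_mf hu).
      case: t => [|t] in IH hu ge *.
        by rewrite leqNgt D0 in ge.
      have [q hq Iq] := redI _ _ ge hu.
      have [c hc] := IH t (ltnSn t) q hq.
      exists c; apply: (ideal_congr_trans idJ) hc.
      by exists q; rewrite mulrBr mulr1 opprB addrA subrK.
  (* The first [#|T|.+1] powers of ['X_i] have coordinates on [#|T|] monomials; a left kernel vector
     of the coordinate matrix gives the coefficients of [q]. *)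
  have alg i : exists2 q, q != 0 & J (pvar i q).
    pose T : finType := 'X_{1..n < D}.
    have [c hc] : exists c : 'I_#|T|.+1 -> T -> K,
        forall a : 'I_#|T|.+1, J ('X_i ^+ a - \sum_(m : T) c a m *: 'X_[m]).
      apply: (@fin_all_exists _ (fun=> T -> K) (fun (a : 'I_#|T|.+1) d =>
        J ('X_i ^+ a - \sum_(m : T) d m *: 'X_[m]))).
      by move=> a; apply: redJ.
    pose C := \matrix_(a < #|T|.+1, b < #|T|) c a (enum_val b).
    have : kermx C != 0.
      by rewrite kermx_eq0 -row_leq_rank -ltnNge ltnS rank_leq_col.
    case/rowV0Pn => u /sub_kermxP uC un0.
    exists (rVpoly u); first by apply: contra un0 => /eqP e; rewrite -(rVpolyK u) e raddf0.
    have -> : pvar i (rVpoly u) = \sum_(a < #|T|.+1) u 0 a *: 'X_i ^+ a.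
      rewrite /rVpoly poly_def rmorph_sum; apply: eq_bigr => a _ /=.
      by rewrite valK -mul_polyC rmorphM rmorphXn /= pvarX pvarC mul_mpolyC.
    have -> : \sum_(a < #|T|.+1) u 0 a *: 'X_i ^+ a =
        \sum_(a < #|T|.+1) u 0 a *: ('X_i ^+ a - \sum_(m : T) c a m *: 'X_[m]) :> S.
      under [RHS]eq_bigr do rewrite scalerBr scaler_sumr.
      rewrite sumrB [X in _ - X]exchange_big /= [X in _ - X]big1 ?subr0 // => m _.
      have /matrixP/(_ 0 (enum_rank m)) := uC; rewrite !mxE => e.
      rewrite -[RHS](scale0r 'X_[m]) -e scaler_suml; apply: eq_bigr => a _.
      by rewrite scalerA mxE enum_rankK.
    by apply: ideal_sum => // a _; apply: idealZ.
  have [y hy] := proper_ideal_point idJ nJ1 alg.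
  have [|p Ip /eqP[]] := nz y.
    exists j; have := hy _ (mem_adjoin idI ('X_j - 1)).
    by rewrite mevalB mevalXU meval1 => /eqP; rewrite subr_eq0 => /eqP ->; rewrite oner_eq0.
  exact/hy/sub_adjoin.
have [T hT] : exists T, I ('X_j ^+ T).
  have [b hb] := J1.
  have hE s : I (pih s 1 + (pih s b - pih s (b * 'X_j))).
    by have := gI s _ hb; rewrite mulrBr mulr1 opprB pihomogD pihomogB.
  have hbt t : I (pih t b + 'X_j ^+ t).
    elim: t => [|t IH].
      have := hE 0%N.
      by rewrite (pihomog_dE (dhomog1 _ _)) (pihomogMr _ _ Xj1) /= subr0 addrC.
    have := hE t.+1.
    rewrite (pihomog_ne0 _ (dhomog1 _ _)) // add0r (pihomogMr _ _ Xj1) /= subn1 /= => h.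
    by have := idealD idI h (idealMr idI 'X_j IH); rewrite mulrDl addrA subrK exprSr.
  by exists (msize b); have := hbt (msize b); rewrite pihomog_ge ?add0r.
have many k t p : (D + k <= t)%N -> p \is t.-homog -> exists q, I (p - q * 'X_j ^+ k).
  elim: k t p => [|k IH] t p le hp; first by exists p; rewrite expr0 mulr1 subrr; apply: ideal0.
  have [|q hq Iq] := redI t p _ hp; first exact: leq_trans (leq_addr _ _) le.
  have [|r Ir] := IH t.-1 q _ hq; first by case: t le {hp hq} => [|t]; rewrite addnS // ltnS.
  exists r; apply: (ideal_congr_trans idI Iq).
  by rewrite exprSr mulrA -mulrBl; apply: idealMr.
exists (D + T)%N => m hm.
have [|q hq] := many T (mdeg m) 'X_[m] hm; first by rewrite dhomogX.
by apply: (ideal_congr idI hq); apply: idealM.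
Qed.

(* Induction on the number [k] of variables outside [I]: restricting to a coordinate
   hyperplane is adjoining a variable to [I]. *)
Lemma graded_nullstellensatz (I : S -> Prop) : is_ideal I -> is_graded I ->
  (forall y : 'I_n -> K, (exists i, y i != 0) -> exists2 p, I p & p.@[y] != 0) ->
  exists D, forall m, (D <= mdeg m)%N -> I 'X_[m].
Proof.
move=> idI gI nz.
suff H k : (k <= n)%N -> forall I, is_ideal I -> is_graded I ->
    (forall y : 'I_n -> K, (exists i, y i != 0) -> exists2 p, I p & p.@[y] != 0) ->
    (forall i : 'I_n, (k <= i)%N -> I 'X_i) ->
    exists D, forall m, (D <= mdeg m)%N -> I 'X_[m].
  by apply: (H n) => // i; rewrite leqNgt ltn_ord.
elim: k => [|k IH] kn {nz gI idI}I idI gI nz hX.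
  exists 1%N => m; rewrite mdegE => h.
  have [i hi] : exists i, m i != 0%N.
    apply/existsP; apply: contraLR h; rewrite negb_exists => /forallP h.
    by rewrite big1 // => i _; have := h i; rewrite negbK => /eqP.
  have : (U_(i) <= m)%MM by rewrite lep1mP.
  by move/submK <-; rewrite mpolyXD; apply: idealM => //; apply: hX.
pose j := Ordinal kn.
have [|||i ki|D hD] := IH (ltnW kn) (adjoin I 'X_j).
- exact: adjoin_ideal.
- by apply: (@adjoin_graded _ _ _ 1%N) => //; rewrite dhomogX /= mdeg1.
- by move=> y /nz[p Ip py]; exists p => //; apply: sub_adjoin.
- have [e|ne] := eqVneq i j; first by rewrite e; apply: mem_adjoin.
  apply: sub_adjoin; apply: hX; rewrite ltn_neqAle ki andbT.
  by apply: contra ne => /eqP e; apply/eqP/val_inj.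
exact: nullstellensatz_step hD.
Qed.

End Nullstellensatz.

(** * Fewer forms than variables: a dimension count *)

Lemma card_le_span (K : fieldType) (V : lmodType K) (T1 T2 : finType)
    (v : T1 -> V) (w : T2 -> V) (c : T1 -> T2 -> K) :
  (forall s, v s = \sum_t c s t *: w t) ->
  (forall u : T1 -> K, \sum_s u s *: v s = 0 -> forall s, u s = 0) ->
  (#|T1| <= #|T2|)%N.
Proof.
move=> hv free; rewrite leqNgt; apply/negP => lt.
pose C := \matrix_(a < #|T1|, b < #|T2|) c (enum_val a) (enum_val b).
have : kermx C != 0.
  by rewrite kermx_eq0 -row_leq_rank -ltnNge (leq_ltn_trans (rank_leq_col _)).
case/rowV0Pn => u /sub_kermxP uC /rV0Pn[a /eqP[]].
rewrite -(enum_valK a); apply: (free (fun s => u 0 (enum_rank s))).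
under eq_bigr do rewrite hv scaler_sumr.
rewrite exchange_big big1 //= => t _.
have /matrixP/(_ 0 (enum_rank t)) := uC; rewrite !mxE => e.
rewrite -[RHS](scale0r (w t)) -e scaler_suml (reindex_onto enum_val enum_rank) /=; last first.
  by move=> s _; rewrite enum_rankK.
apply: eq_big => b; first by rewrite enum_valK eqxx.
by rewrite scalerA mxE enum_valK enum_rankK.
Qed.

Section Counting.
Variables (n r : nat) (K : fieldType) (f : 'I_r -> {mpoly K[n]}) (d : 'I_r -> nat).
Hypotheses (f_homog : forall i, f i \is (d i).-homog) (d_gt0 : forall i, (0 < d i)%N).
Local Notation S := {mpoly K[n]}.
Local Notation pih := (pihomog mdeg).

Definition gen_ideal (p : S) := exists a : 'I_r -> S, p = \sum_i a i * f i.

Lemma gen_ideal_ideal : is_ideal gen_ideal.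
Proof.
split.
- by exists (fun=> 0); rewrite big1 // => i _; rewrite mul0r.
- move=> p q [a ->] [b ->]; exists (fun i => a i + b i).
  by rewrite -big_split; apply: eq_bigr => i _; rewrite mulrDl.
- move=> p q [b ->]; exists (fun i => p * b i).
  by rewrite mulr_sumr; apply: eq_bigr => i _; rewrite mulrA.
Qed.

Lemma gen_ideal_pihomog t a :
  pih t (\sum_i a i * f i) =
  \sum_i (if (d i <= t)%N then pih (t - d i) (a i) else 0) * f i.
Proof.
rewrite raddf_sum; apply: eq_bigr => i _ /=; rewrite (pihomogMr _ _ (f_homog i)).
by case: ifP => // _; rewrite mul0r.
Qed.

Lemma gen_ideal_graded : is_graded gen_ideal.
Proof. by move=> t p [a ->]; rewrite gen_ideal_pihomog; eexists. Qed.

Lemma gen_ideal_gen i : gen_ideal (f i).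
Proof.
exists (fun k => (k == i)%:R); rewrite (bigD1 i) //= eqxx mul1r big1 ?addr0 //.
by move=> k /negbTE ->; rewrite mul0r.
Qed.

(* [S] is spanned over [K[f_1..f_r]] by the monomials of degree [< D]. *)
Lemma spanned_over_generators D t p :
  (forall m, (D <= mdeg m)%N -> gen_ideal 'X_[m]) -> p \is t.-homog ->
  exists2 A : 'X_{1..n < D} -> {mpoly K[r]},
    (forall b, (msize (A b) <= t.+1)%N) &
    p = \sum_b mmap (@mpolyC n K) f (A b) * 'X_[b].
Proof.
move=> hD; elim/ltn_ind: t p => t IH p hp; have [lt|ge] := ltnP t D.
  exists (fun b => (p@_b)%:MP) => [b|]; first by rewrite msizeC; case: (_ != _).
  rewrite {1}(@mpolywE _ _ D p); last first.
    rewrite msizeE big_seq; apply/bigmax_leqP_seq => m _ hm.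
    by rewrite (dhomog_mf hp).
  by apply: eq_bigr => b _; rewrite mmapC mul_mpolyC.
have [a ha] : gen_ideal p.
  rewrite [p]mpolyE big_seq; apply: (ideal_sum gen_ideal_ideal) => m hm.
  by apply/(idealZ gen_ideal_ideal)/hD; rewrite (dhomog_mf hp hm).
(* The coefficients may be taken homogeneous of degree [t - d i < t], so the induction applies to
   them. Multiplying [A i] by the variable ['X_i], which stands for [f i], raises its size by at
   most one. *)
pose a' i := if (d i <= t)%N then pih (t - d i) (a i) else 0.
have {}ha : p = \sum_i a' i * f i by rewrite -gen_ideal_pihomog -ha pihomog_dE.
have [A hA] : exists A : 'I_r -> 'X_{1..n < D} -> {mpoly K[r]}, forall i,
    (forall b, (msize (A i b) <= t)%N) /\
    a' i = \sum_b mmap (@mpolyC n K) f (A i b) * 'X_[b].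
  apply: (@fin_all_exists _ (fun=> 'X_{1..n < D} -> {mpoly K[r]})
    (fun i B => (forall b, (msize (B b) <= t)%N) /\
    a' i = \sum_b mmap (@mpolyC n K) f (B b) * 'X_[b])) => i.
  rewrite /a'; case: leqP => h; last first.
    exists (fun=> 0); split => [b|]; first by rewrite msize0.
    by rewrite big1 // => b _; rewrite mmap0 mul0r.
  have lt : (t - d i < t)%N by rewrite ltn_subrL d_gt0 (leq_trans (d_gt0 i)).
  have [B hB1 hB2] := IH _ lt _ (pihomogP mdeg (t - d i) (a i)).
  by exists B; split => // b; apply: leq_trans (hB1 b) _.
exists (fun b => \sum_i A i b * 'X_i) => [b|].
  apply: (leq_trans (msize_sum _ _ _)); apply/bigmax_leqP => i _.
  have [->|An0] := eqVneq (A i b) 0; first by rewrite mul0r msize0.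
  by rewrite msizeM ?msizeX ?mdeg1 ?addn2 ?ltnS //; [case: (hA i) | rewrite -msize_poly_eq0 msizeX].
rewrite ha; under [RHS]eq_bigr do rewrite rmorph_sum mulr_suml.
rewrite exchange_big; apply: eq_bigr => i _ /=.
case: (hA i) => _ ->; rewrite mulr_suml; apply: eq_bigr => b _.
by rewrite rmorphM /= mmapX mmap1U mulrAC.
Qed.

(** The [(q+1)^n] monomials with exponents at most [q] have degree at most [t = n q], so they lie in
    the span of at most [B (t+1)^r] products. With [q = B n^r] and [r < n] this is absurd:
    [B (n q + 1)^r <= q (q+1)^r < (q+1)^n]. *)
Lemma vars_le_generators D :
  (forall m, (D <= mdeg m)%N -> gen_ideal 'X_[m]) -> (n <= r)%N.
Proof.
move=> hD; rewrite leqNgt; apply/negP => rn.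
pose B := #|{: 'X_{1..n < D}}|; pose q := (B * n ^ r)%N; pose t := (n * q)%N.
pose T1 : finType := {ffun 'I_n -> 'I_q.+1}.
pose T2 : finType := ('X_{1..n < D} * 'X_{1..r < t.+1})%type.
pose mon (s : T1) : 'X_{1..n} := [multinom val (s i) | i < n].
have mon_deg s : (mdeg (mon s) <= t)%N.
  rewrite mdegE /t -[X in (X * _)%N]card_ord -sum_nat_const; apply: leq_sum => i _.
  by rewrite mnmE -ltnS ltn_ord.
have mon_inj : injective mon.
  move=> s1 s2 e; apply/ffunP => i; apply: val_inj.
  by have /(congr1 (fun m : 'X_{1..n} => m i)) := e; rewrite !mnmE.
have [c hc] : exists c : T1 -> T2 -> K, forall s,
    'X_[mon s] = \sum_u c s u *: (mmap (@mpolyC n K) f 'X_[u.2] * 'X_[u.1]).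
  apply: (@fin_all_exists _ (fun=> T2 -> K) (fun s d0 =>
    'X_[mon s] = \sum_u d0 u *: (mmap (@mpolyC n K) f 'X_[u.2] * 'X_[u.1]))) => s.
  have hs : 'X_[mon s] \is [in K[n], (mdeg (mon s)).-homog] by rewrite dhomogX.
  have [A hA ->] := spanned_over_generators hD hs.
  exists (fun u : T2 => (A u.1)@_(bmnm u.2)).
  rewrite -(pair_bigA _ (fun (b : 'X_{1..n < D}) (a : 'X_{1..r < t.+1}) =>
    (A b)@_a *: (mmap (@mpolyC n K) f 'X_[a] * 'X_[b]))) /=.
  apply: eq_bigr => b _.
  rewrite {1}(@mpolywE _ _ t.+1 (A b)); last by apply: leq_trans (hA b) _; rewrite ltnS.
  rewrite rmorph_sum mulr_suml; apply: eq_bigr => a _ /=.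
  by rewrite mmapZ mul_mpolyC scalerAl.
have free (u : T1 -> K) : \sum_s u s *: 'X_[mon s] = 0 :> S -> forall s, u s = 0.
  move=> hu s; have /(congr1 (mcoeff (mon s))) := hu; rewrite raddf_sum mcoeff0 (bigD1 s) //=.
  rewrite mcoeffZ mcoeffX eqxx mulr1 big1 ?addr0 // => s' ne.
  by rewrite mcoeffZ mcoeffX (inj_eq mon_inj) (negbTE ne) mulr0.
have := card_le_span hc free.
rewrite card_ffun !card_ord card_prod -/B.
have cr : (#|{: 'X_{1..r < t.+1}}| <= t.+1 ^ r)%N.
  pose g (a : 'X_{1..r < t.+1}) : {ffun 'I_r -> 'I_t.+1} := [ffun i => inord (bmnm a i)].
  rewrite -[X in (_ <= _ ^ X)%N]card_ord -[X in (_ <= X ^ _)%N](card_ord t.+1) -card_ffun.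
  apply: (@leq_card _ _ g) => a1 a2 e; apply/val_inj/mnmP => i.
  have bd (a : 'X_{1..r < t.+1}) : (bmnm a i < t.+1)%N.
    by apply: leq_ltn_trans (bmdeg a); rewrite mdegE (bigD1 i) //= leq_addr.
  by have /ffunP/(_ i) := e; rewrite !ffunE => /(congr1 val); rewrite /= !inordK.
have n0 : (0 < n)%N by apply: leq_ltn_trans rn.
apply/negP; rewrite -ltnNge; apply: leq_ltn_trans (leq_mul (leqnn B) cr) _.
have h1 : (t.+1 ^ r <= (n * q.+1) ^ r)%N.
  have : (t.+1 <= n * q.+1)%N by rewrite mulnS /t -add1n leq_add2r.
  by case: (r) => // k; rewrite leq_exp2r.
apply: leq_ltn_trans (leq_mul (leqnn B) h1) _.
rewrite expnMn mulnA -/q; apply: (@leq_trans (q.+1 * q.+1 ^ r)).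
  by rewrite ltn_pmul2r // expn_gt0.
by rewrite -expnS leq_pexp2l.
Qed.

End Counting.

(** Without a common zero, the graded Nullstellensatz puts all monomials of large degree in the
    ideal of the [f i], and the dimension count gives [n <= r]. *)
Theorem forms_common_zero (n r : nat) (K : closedFieldType) (f : 'I_r -> {mpoly K[n]})
    (d : 'I_r -> nat) :
  (forall i, f i \is (d i).-homog) -> (forall i, (0 < d i)%N) -> (r < n)%N ->
  exists2 y : 'I_n -> K, exists i, y i != 0 & forall i, (f i).@[y] = 0.
Proof.
move=> hf hd rn; apply: NNPP => no.
have [|D hD] := graded_nullstellensatz (gen_ideal_ideal f) (gen_ideal_graded hf).
  move=> y hy; apply: NNPP => hp; apply: no; exists y => // i; apply/eqP/negP => /negP ne.
  by apply: hp; exists (f i) => //; apply: gen_ideal_gen.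
by have := vars_le_generators hf hd hD; rewrite leqNgt rn.
Qed.

(** * Restriction of forms to lines *)

Lemma poly_ext_nat (K : numDomainType) (p q : {poly K}) :
  (forall t : nat, p.[t%:R] = q.[t%:R]) -> p = q.
Proof.
move=> h; apply/eqP; rewrite -subr_eq0; apply/eqP.
apply: (@roots_geq_poly_eq0 _ _ [seq i%:R | i <- iota 0 (size (p - q))]).
- by apply/allP => _ /mapP[i _ ->]; rewrite rootE hornerD hornerN h subrr.
- by rewrite map_inj_uniq ?iota_uniq // => i j /eqP; rewrite eqr_nat => /eqP.
- by rewrite size_map size_iota.
Qed.

Lemma poly_ext (K : numDomainType) (p q : {poly K}) :
  (forall t, p.[t] = q.[t]) -> p = q.
Proof. by move=> h; apply: poly_ext_nat. Qed.

Lemma poly_nonroot (K : numDomainType) (p : {poly K}) : p != 0 -> exists t, p.[t] != 0.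
Proof.
move=> pn0; apply: NNPP => h; case/eqP: pn0; apply: poly_ext => t.
by rewrite horner0; apply/eqP; apply: contra_notT h; exists t.
Qed.

Section Line.
Variables (n : nat) (K : comNzRingType).
Implicit Types F : {mpoly K[n]}.

Lemma dhomog_mderiv d F i : F \is d.-homog -> F^`M(i) \is d.-1.-homog.
Proof.
move=> hF; apply/dhomogP => mm; rewrite mcoeff_msupp mcoeff_deriv => h.
have : (mm + U_(i))%MM \in msupp F.
  by rewrite mcoeff_msupp; apply: contra h => /eqP ->; rewrite mul0rn.
by move/(dhomog_mf hF); rewrite /= mdegD mdeg1 addn1 => <-.
Qed.

Section Gline.
Variables (R : comNzRingType) (f : {rmorphism K -> R}).

(** The polynomial [F(a + X b)]. The coefficients go through [f] so that [R = {poly K}] gives a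
    family of lines with a parameter. *)
Definition gline F (a b : 'I_n -> R) : {poly R} :=
  mmap (polyC \o f) (fun i => (a i)%:P + b i *: 'X) F.

Lemma gline_deriv F a b : (gline F a b)^`() = \sum_i b i *: gline F^`M(i) a b.
Proof.
elim/mpoly_ring_ind: F => [c|i|p q hp hq|p q hp hq].
- rewrite /gline mmapC derivC big1 // => i _; rewrite mderivC mmap0 scaler0 //.
- rewrite /gline mmapX mmap1U derivD derivC add0r derivZ derivX (bigD1 i) //=.
  rewrite mderivX mnm1E eqxx scale1r -[X in (X - _)%MM]add0m addmK mpolyX0 rmorph1.
  rewrite big1 ?addr0 // => k ne.
  by rewrite mderivX mnm1E eq_sym (negbTE ne) scale0r rmorph0 scaler0.
- rewrite {1}/gline rmorphD /= derivD -!/(gline _ _ _) hp hq -big_split.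
  by apply: eq_bigr => i _ /=; rewrite mderivD /gline rmorphD scalerDr.
- rewrite {1}/gline rmorphM /= derivM -!/(gline _ _ _) hp hq mulr_suml mulr_sumr -big_split.
  apply: eq_bigr => i _ /=; rewrite mderivM /gline rmorphD !rmorphM /= scalerDr.
  by rewrite scalerAl scalerAr.
Qed.

(** The degree [k d] is formal: its coefficient may vanish. The case [k = 1] serves for lines, a
    general [k] for orbits of unipotent matrices. *)
Lemma mmap_top d k F (h : 'I_n -> {poly R}) : F \is d.-homog ->
  (forall i, (size (h i) <= k.+1)%N) ->
  (size (mmap (polyC \o f) h F) <= (k * d).+1)%N /\
  (mmap (polyC \o f) h F)`_(k * d) = mmap f (fun i => (h i)`_k) F.
Proof.
move=> hF sh; rewrite /mmap.
pose top l (p : {poly R}) c := (size p <= l.+1)%N /\ p`_l = c.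
rewrite -/(top (k * d)%N _ _).
have topM l l' p q c c' : top l p c -> top l' q c' -> top (l + l')%N (p * q) (c * c').
  move=> [sp <-] [sq <-]; split.
    by apply: (leq_trans (size_polyMleq _ _)); lia.
  have lt : (l < (l + l').+1)%N by rewrite ltnS leq_addr.
  rewrite coefM (bigD1 (Ordinal lt)) //= addKn big1 ?addr0 // => j ne.
  case: (ltngtP l j) => [lj|jl|e]; last by case/eqP: ne; apply: val_inj.
    by rewrite nth_default ?mul0r // (leq_trans sp).
  rewrite [q`__]nth_default ?mulr0 // (leq_trans sq) //; lia.
have topE mm : top (k * mdeg mm)%N (mmap1 h mm) (mmap1 (fun i => (h i)`_k) mm).
  rewrite mdegE big_distrr /mmap1 /=; elim/big_rec3: _ => [|i p c l _ hl].
    by split; rewrite ?size_poly1 ?coefC.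
  apply: (topM) => //; elim: (mm i) => [|j IH].
    by rewrite muln0; split; rewrite ?expr0 ?size_poly1 ?coefC.
  by rewrite !exprS mulnS; apply: (topM) => //; split.
rewrite big_seq [X in top _ _ X]big_seq.
elim/big_rec2: _ => [|mm p c hm [sp <-]]; first by split; rewrite ?size_poly0 ?coef0.
have [s1 e1] := topE mm; rewrite (dhomog_mf hF hm) /= in s1 e1.
split; last by rewrite coefD coefCM e1.
apply: (leq_trans (size_polyD _ _)); rewrite geq_max sp andbT mul_polyC.
exact: leq_trans (size_scale_leq _ _) s1.
Qed.

Lemma gline_top d F a b : F \is d.-homog ->
  (size (gline F a b) <= d.+1)%N /\ (gline F a b)`_d = mmap f b F.
Proof.
move=> hF; have [i|] := @mmap_top d 1 F (fun i => (a i)%:P + b i *: 'X) hF.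
  apply: (leq_trans (size_polyD _ _)); rewrite geq_max.
  rewrite (leq_trans (size_polyC_leq1 _)) //=.
  by apply: (leq_trans (size_scale_leq _ _)); rewrite size_polyX.
rewrite mul1n => s1 e1; split => //; rewrite /gline e1 /mmap; apply: eq_bigr => mm _.
congr (_ * _); apply: eq_bigr => i _.
by rewrite coefD coefC coefZ coefX mulr1 add0r.
Qed.

End Gline.

Lemma rmorph_mmap (R R' : comNzRingType) (f : {rmorphism K -> R}) (g : {rmorphism R -> R'})
    (h : 'I_n -> R) F : g (mmap f h F) = mmap (g \o f) (g \o h) F.
Proof.
rewrite /mmap rmorph_sum; apply: eq_bigr => mm _; rewrite rmorphM rmorph_prod /=.
by congr (_ * _); apply: eq_bigr => i _; rewrite rmorphXn.
Qed.

End Line.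

Section Points.
Variables (n : nat) (K : numFieldType).
Implicit Types (F : {mpoly K[n]}) (x v : 'cV[K]_n) (A : 'M[K]_n).

Definition ev F x : K := F.@[fun i => x i 0].
Definition grad F x : 'rV[K]_n := \row_i ev F^`M(i) x.
Definition line F x v : {poly K} := gline idfun F (fun i => x i 0) (fun i => v i 0).

Lemma line_horner F x v t : (line F x v).[t] = ev F (x + t *: v).
Proof.
rewrite -/(horner_eval t _) /line /gline rmorph_mmap /ev /meval /mmap.
apply: eq_bigr => mm _ /=; rewrite /horner_eval hornerC; congr (_ * _).
apply: eq_bigr => i _ /=; rewrite /horner_eval !hornerE !mxE mulrC //.
Qed.

Lemma line_deriv0 F x v : (line F x v)^`().[0] = (grad F x *m v) 0 0.
Proof.
rewrite gline_deriv horner_sum !mxE; apply: eq_bigr => i _.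
by rewrite hornerZ -/(line _ _ _) line_horner scale0r addr0 mxE mulrC.
Qed.

Lemma line_top d F x v : F \is d.-homog ->
  (size (line F x v) <= d.+1)%N /\ (line F x v)`_d = ev F v.
Proof. exact: gline_top. Qed.

Lemma evZ d F c x : F \is d.-homog -> ev F (c *: x) = c ^+ d * ev F x.
Proof.
move=> hF; rewrite /ev !mevalE mulr_sumr !big_seq; apply: eq_bigr => mm hm.
rewrite mulrCA; congr (_ * _); rewrite -(dhomog_mf hF hm) /= mdegE -prodrXr -big_split /=.
by apply: eq_bigr => i _; rewrite mxE exprMn.
Qed.

Lemma gradZ d F c x : F \is d.-homog -> grad F (c *: x) = c ^+ d.-1 *: grad F x.
Proof.
move=> hF; apply/rowP => i; rewrite !mxE (@evZ d.-1) //.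
exact: dhomog_mderiv.
Qed.

(** Differentiate [F(x + t x) = (1 + t)^d F(x)] at [t = 0]. *)
Lemma euler d F x : F \is d.-homog -> (grad F x *m x) 0 0 = d%:R * ev F x.
Proof.
move=> hF; rewrite -line_deriv0.
have -> : line F x x = ev F x *: (1 + 'X) ^+ d.
  apply: poly_ext => t; rewrite line_horner hornerZ horner_exp !hornerE mulrC.
  by rewrite -[X in X + _]scale1r -scalerDl (evZ _ _ hF).
rewrite derivZ deriv_exp derivD derivC derivX add0r mul1r hornerZ hornerMn horner_exp.
by rewrite !hornerE expr1n mulrC.
Qed.

(** Gradients are row vectors. [F] takes the same values on [A x + t A v] and on [x + t v]; compare
    the derivatives at [t = 0]. *)
Lemma chain_rule F A x : (forall y, ev F (A *m y) = ev F y) ->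
  grad F (A *m x) *m A = grad F x.
Proof.
move=> h; apply/rowP => i.
have key v : (grad F (A *m x) *m (A *m v)) 0 0 = (grad F x *m v) 0 0.
  rewrite -!line_deriv0 (_ : line F (A *m x) (A *m v) = line F x v) //.
  by apply: poly_ext => t; rewrite !line_horner -[RHS]h mulmxDr scalemxAr.
have := key (delta_mx i 0); rewrite mulmxA -!colE !mxE //.
Qed.

End Points.

(** * Separability of a specialized polynomial *)

Section SeparableSpecialization.
Variable K : numClosedFieldType.

(** Write [p = R h] with [h] the gcd. As [h] divides [p'], it divides [R h']; in characteristic [0]
    the derivative [h'] vanishes at [t] to a lower order than [h], so [R] vanishes at [t]. *)
Lemma root_div_gcd_deriv (p : {poly K}) t : p != 0 -> root (gcdp p p^`()) t ->
  root (p %/ gcdp p p^`()) t.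
Proof.
move=> pn0; set h := gcdp _ _; set R := p %/ h => rt.
have hn0 : h != 0 by rewrite gcdp_eq0 negb_and pn0.
have eP : p = R * h by rewrite divpK // dvdp_gcdl.
have : h %| R * h^`().
  have : h %| p^`() by apply: dvdp_gcdr.
  by rewrite {1}eP derivM dvdp_addr // dvdp_mull.
have [k [q]] := multiplicity_XsubC h t; rewrite hn0 /= => nq eh.
case: k eh => [|k] eh; first by rewrite eh expr0 mulr1 (negbTE nq) in rt.
move/(dvdp_trans (_ : ('X - t%:P) ^+ k.+1 %| h)); rewrite {1}eh dvdp_mull // => /(_ isT).
rewrite eh derivM deriv_exp derivXsubC mul1r mulrDr dvdp_addr; last first.
  by rewrite mulrA dvdp_mull.
rewrite /= exprS mulrnAr mulrnAr -mulrnAl !mulrA dvdp_mul2r ?expf_neq0 ?polyXsubC_eq0 //.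
rewrite dvdp_XsubCl rootM (negbTE nq) orbF rootE hornerMn mulrn_eq0 //.
Qed.

(** In [{poly {poly K}}] the inner variable is the parameter [s]. Mapping [coefp 1] extracts the
    term of order 1 in [s] and mapping [horner_eval 0] the term of order 0, whence a Leibniz
    rule. *)
Lemma coef1_mul (A B : {poly {poly K}}) :
  map_poly (coefp 1) (A * B) =
  map_poly (coefp 1) A * map_poly (horner_eval 0) B
  + map_poly (horner_eval 0) A * map_poly (coefp 1) B.
Proof.
apply/polyP => i; rewrite coefD !coefM [LHS]coef_map_id0 ?/coefp ?coef0 //= coefM coef_sum.
rewrite -big_split; apply: eq_bigr => k _ /=.
rewrite !coef_map_id0 ?coef0 ?/horner_eval ?horner0 // !horner_coef0.
by rewrite coefM !big_ord_recl big_ord0 /= addr0 addrC.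
Qed.

Lemma eval0_divX (A : {poly {poly K}}) : map_poly (horner_eval 0) A = 0 ->
  exists B, A = 'X *: B.
Proof.
move=> h; exists (map_poly (fun a => a %/ 'X) A); apply/polyP => i.
rewrite coefZ coef_map_id0 ?div0p // mulrC divpK //.
have /polyP/(_ i) := h; rewrite coef_map coef0 /= /horner_eval => /eqP r.
by rewrite -['X]subr0 dvdp_XsubCl.
Qed.

(* If [P] and [P'] had a common factor over [K(s)] then [W P' = U P] with [deg W < deg P],
   and one may assume that [W] is nonzero at [s = 0].  The terms of order 0 and 1 in [s]
   of this identity force [P(0, t)] to divide [W(0, t)]. *)
Lemma separable_specialization (P : {poly {poly K}}) (d : nat) c :
  (1 < d)%N -> size P = d.+1 -> lead_coef P = c%:P ->
  (forall t, root (map_poly (horner_eval 0) P) t ->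
     root (map_poly (horner_eval 0) P)^`() t -> (map_poly (coefp 1) P).[t] != 0) ->
  exists2 r : {poly K}, r != 0 & forall s, r.[s] != 0 ->
    separable_poly (map_poly (horner_eval s) P).
Proof.
move=> d1 szP lcP hP.
set P0 := map_poly (horner_eval 0) P in hP *; set P1 := map_poly _ P in hP.
have cn0 : c != 0 by rewrite -(polyC_eq0 c) -lcP lead_coef_eq0 -size_poly_gt0 szP.
have szP' : size P^`() = d.
  apply/eqP; rewrite eqn_leq; apply/andP; split.
    by rewrite -ltnS -szP lt_size_deriv // -size_poly_gt0 szP.
  rewrite leqNgt; apply/negP => lt.
  have /eqP : P^`()`_d.-1 = 0 by apply: nth_default; rewrite -ltnS prednK // ltnW.
  rewrite coef_deriv prednK ?(ltnW d1) //.
  have <- : lead_coef P = P`_d by rewrite /lead_coef szP.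
  by rewrite lcP -polyCMn polyC_eq0 mulrn_eq0 (negbTE cn0) orbF; lia.
have szP0 : size P0 = d.+1.
  by rewrite size_map_poly_id0 // lcP /= /horner_eval hornerC.
have P0n0 : P0 != 0 by rewrite -size_poly_gt0 szP0.
(* [N] bounds the size of the leading coefficient of [W]. If [W] vanishes at [s = 0] then so does
   [U], and dividing both by [s] lowers [N]. *)
have noWU N : forall W U : {poly {poly K}}, W != 0 -> (size W <= d)%N -> W * P^`() = U * P ->
    (size (lead_coef W) <= N)%N -> False.
  elim: N => [|N IH] W U Wn0 sW eWU sN.
    by rewrite leqn0 size_poly_eq0 lead_coef_eq0 (negbTE Wn0) in sN.
  pose W0 := map_poly (horner_eval 0) W; pose U0 := map_poly (horner_eval 0) U.
  have e0 : W0 * P0^`() = U0 * P0.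
    by have := congr1 (map_poly (horner_eval 0)) eWU; rewrite !rmorphM /= deriv_map.
  have [W00|W0n0] := eqVneq W0 0.
    have U00 : U0 = 0.
      by apply/eqP; move/eqP: e0; rewrite W00 mul0r eq_sym mulf_eq0 (negbTE P0n0) orbF.
    have [W2 eW] := eval0_divX W00; have [U2 eU] := eval0_divX U00.
    have W2n0 : W2 != 0 by apply: contra Wn0 => /eqP e; rewrite eW e scaler0.
    apply: (IH W2 U2) => //.
    - by move: sW; rewrite eW size_scale ?polyX_eq0.
    - apply: (@mulfI _ 'X%:P); first by rewrite polyC_eq0 polyX_eq0.
      by rewrite !mulrA !mul_polyC -eW -eU.
    - move: sN; rewrite eW lead_coefZ size_mul ?polyX_eq0 ?lead_coef_eq0 //.
      by rewrite size_polyX.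
  have e1 : map_poly (coefp 1) W * P0^`() + W0 * P1^`() =
      map_poly (coefp 1) U * P0 + U0 * P1.
    have := congr1 (map_poly (coefp 1)) eWU; rewrite !coef1_mul -deriv_map.
    suff -> : map_poly (coefp 1) P^`() = P1^`() by [].
    apply/polyP => i; rewrite [LHS]coef_map_id0 ?/coefp ?coef0 //= !coef_deriv /P1.
    by rewrite coef_map_id0 ?/coefp ?coef0 //= coefMn.
  pose h := gcdp P0 P0^`(); pose R := P0 %/ h; pose R' := P0^`() %/ h.
  have hn0 : h != 0 by rewrite gcdp_eq0 negb_and P0n0.
  have eR : P0 = R * h by rewrite divpK // dvdp_gcdl.
  have eR' : P0^`() = R' * h by rewrite divpK // dvdp_gcdr.
  have Rn0 : R != 0 by apply: contra P0n0 => /eqP e; rewrite eR e mul0r.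
  have coRR' : coprimep R R' by apply: coprimep_div_gcd; rewrite P0n0.
  have e0' : W0 * R' = U0 * R by apply: (mulIf hn0); rewrite -!mulrA -eR -eR'.
  have /dvdpP[Z eW] : R %| W0 by rewrite -(Gauss_dvdpl _ coRR') e0' dvdp_mull.
  have eU : U0 = Z * R'.
    by apply: (mulIf Rn0); rewrite -e0' eW mulrAC.
  have key : Z * (R * P1^`() - R' * P1) =
      h * (map_poly (coefp 1) U * R - map_poly (coefp 1) W * R').
    move: e1; rewrite eW eU eR' {1}eR => /eqP; rewrite -subr_eq0 => /eqP e.
    by apply/eqP; rewrite -subr_eq0 -[X in _ == X]e; apply/eqP; ring.
  (* A root of [h] is a common root of [P0] and its derivative: there [R] vanishes while [R'] and
     [P1] do not. Hence [h] divides [Z], and [P0 = R h] divides [W0], which has smaller degree. *)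
  have coh : coprimep h (R * P1^`() - R' * P1).
    apply: Pdiv.ClosedField.root_coprimep => t rt.
    have Rt := root_div_gcd_deriv P0n0 rt.
    have /andP[r0 r1] : root P0 t && root P0^`() t by rewrite -root_gcd.
    rewrite !hornerE (eqP Rt) mul0r sub0r oppr_eq0 mulf_neq0 ?hP //.
    exact: (coprimep_root coRR' Rt).
  have /(dvdp_mul (dvdpp R)) : h %| Z by rewrite -(Gauss_dvdpl _ coh) key dvdp_mulr.
  rewrite -eR [R * Z]mulrC -eW => /dvdp_leq => /(_ W0n0); rewrite szP0 ltnNge.
  by rewrite (leq_trans (size_poly _ _)).
(* A nonzero resultant serves as [r], because its Bezout identity specializes at each [s]. A zero
   resultant gives a nontrivial gcd, whose cofactors contradict [noWU]. *)
have [r0|rn0] := eqVneq (resultant P P^`()) 0; last first.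
  exists (resultant P P^`()) => // s rs.
  have s1 : (1 < size P)%N by rewrite szP ltnW.
  have s2 : (1 < size P^`())%N by rewrite szP'.
  have [[u v] /= _ e] := resultant_in_ideal s1 s2.
  have := congr1 (map_poly (horner_eval s)) e.
  rewrite rmorphD !rmorphM /= map_polyC /= /horner_eval -/(horner_eval s) -deriv_map => {}e.
  rewrite separable_poly.unlock; apply/Bezout_eq1_coprimepP.
  exists ((resultant P P^`()).[s]^-1 *: map_poly (horner_eval s) u,
          (resultant P P^`()).[s]^-1 *: map_poly (horner_eval s) v).
  by rewrite /= -!scalerAl -scalerDr -e scale_polyC mulVf.
exfalso; move/eqP: r0; rewrite resultant_eq0; set g := gcdp _ _ => sg.
have /Pdiv.Idomain.dvdpP[[c1 W] /= c1n0 eW] : g %| P by apply: Pdiv.Idomain.dvdp_gcdl.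
have /Pdiv.Idomain.dvdpP[[c2 U] /= c2n0 eU] : g %| P^`() by apply: Pdiv.Idomain.dvdp_gcdr.
have gn0 : g != 0 by rewrite -size_poly_gt0 ltnW.
have Wn0 : W != 0.
  apply: contraTneq c1n0 => W0; move/eqP: eW.
  by rewrite W0 mul0r scale_poly_eq0 -size_poly_eq0 szP orbF => /eqP ->; rewrite eqxx.
apply: (noWU _ (c2 *: W) (c1 *: U) _ _ _ (leqnn _)).
- by rewrite scale_poly_eq0 negb_or c2n0.
- have := congr1 (fun p => size (polyseq p)) eW; rewrite /= !size_scale // szP size_mul //.
  by move: sg; lia.
- by rewrite -!scalerAl !scalerAr eU eW; rewrite mulrCA mulrA.
Qed.

End SeparableSpecialization.

(** * Linear maps preserving the zero set *)

(** On the curve [v = (1, z, z^2, ...)] the product [u v] is the value at [z] of the polynomial with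
    coefficients [u], and a finite product of nonzero polynomials has a nonroot. *)
Lemma avoid_hyperplanes (K : numFieldType) n (s : seq 'rV[K]_n) :
  (forall u, u \in s -> u != 0) ->
  exists v : 'cV[K]_n, forall u, u \in s -> (u *m v) 0 0 != 0.
Proof.
move=> h; have : \prod_(u <- s) rVpoly u != 0.
  rewrite prodf_seq_neq0; apply/allP => u us /=; apply: contra (h u us) => /eqP e.
  by rewrite -(rVpolyK u) e raddf0.
case/poly_nonroot => z; rewrite horner_prod prodf_seq_neq0 => /allP hz.
exists (\col_i z ^+ i) => u us; have := hz u us; rewrite /=.
rewrite /rVpoly horner_poly !mxE; congr (_ != 0).
by apply: eq_bigr => i _; rewrite mxE valK.
Qed.

Section Preserving.
Variables (n d : nat) (K : numClosedFieldType) (F : {mpoly K[n]}).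
Hypotheses (d_gt1 : (1 < d)%N) (F_homog : F \is d.-homog).
Hypothesis F_smooth : forall x : 'cV[K]_n, x != 0 -> grad F x != 0.
Implicit Types (x p v : 'cV[K]_n) (A : 'M[K]_n).

Lemma ev0 : ev F 0 = 0.
Proof. by rewrite -(scale0r 0) (evZ _ _ F_homog) expr0n; case: d d_gt1 => // k; rewrite mul0r. Qed.

(** Take [v] outside the kernels of [grad F] at the finitely many zeros of [F] on the line
    [x + t p]. Then [F(x + s v + t p)] has at [s = 0] a nonzero derivative in [s] at each root [t],
    as [separable_specialization] asks for double roots. *)
Lemma separable_lines x p : ev F p != 0 -> (forall t, x + t *: p != 0) ->
  exists v, exists2 r : {poly K}, r != 0 & forall s, r.[s] != 0 ->
    separable_poly (line F (x + s *: v) p).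
Proof.
move=> Fp xp; have [rs ers] := closed_field_poly_normal (line F x p).
have [v hv] : exists v, forall u, u \in [seq grad F (x + t *: p) | t <- rs] -> (u *m v) 0 0 != 0.
  by apply: avoid_hyperplanes => _ /mapP[t _ ->]; apply: F_smooth.
exists v.
(* The outer variable of [P] is [t], the inner one is [s]. *)
pose P : {poly {poly K}} := gline polyC F (fun i => (x i 0)%:P + v i 0 *: 'X) (fun i => (p i 0)%:P).
have Ps s : map_poly (horner_eval s) P = line F (x + s *: v) p.
  rewrite /P /gline rmorph_mmap /line /gline /mmap; apply: eq_bigr => mm _.
  congr (_ * _); first by rewrite /= map_polyC /= /horner_eval hornerC.
  apply: eq_bigr => i _ /=; congr (_ ^+ _).
  rewrite rmorphD /= map_polyC map_polyZ map_polyX /= /horner_eval !hornerE !mxE mulrC //.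
have Pt t : P.[t%:P] = line F (x + t *: p) v.
  rewrite -/(horner_eval t%:P P) /P /gline rmorph_mmap /line /gline /mmap.
  apply: eq_bigr => mm _; congr (_ * _); first by rewrite /= /horner_eval hornerC.
  apply: eq_bigr => i _ /=; congr (_ ^+ _).
  by rewrite /horner_eval !hornerE !mxE polyCD polyCM addrAC [_ * t%:P]mulrC.
have [sP cP] := gline_top polyC (fun i => (x i 0)%:P + v i 0 *: 'X) (fun i => (p i 0)%:P) F_homog.
rewrite -/P in sP cP.
have {}cP : P`_d = (ev F p)%:P by rewrite cP /ev /meval rmorph_mmap.
have szP : size P = d.+1.
  apply/eqP; rewrite eqn_leq sP /= ltnNge; apply/negP => /(nth_default 0) /eqP.
  by rewrite cP polyC_eq0 (negbTE Fp).
have lP : lead_coef P = (ev F p)%:P by rewrite /lead_coef szP.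
have P1t t : (map_poly (coefp 1) P).[t] = (grad F (x + t *: p) *m v) 0 0.
  rewrite -line_deriv0 horner_coef0 coef_deriv mulr1n -Pt.
  rewrite (horner_coef_wide _ (size_poly _ _)) horner_coef coef_sum.
  apply: eq_bigr => i _; rewrite coef_map_id0 /coefp ?coef0 //=.
  by rewrite -polyC_exp coefMC.
have [|r rn0 hr] := separable_specialization d_gt1 szP lP.
  move=> t; rewrite Ps scale0r addr0 => rt _; rewrite P1t; apply: hv; apply: map_f.
  move: rt; rewrite ers rootZ ?root_prod_XsubC // lead_coef_eq0.
  have := line_top x p F_homog => -[_ e]; apply: contra Fp => /eqP l0.
  by rewrite -e l0 coef0.
by exists r => // s /hr; rewrite Ps.
Qed.

(** On a generic line [z + t p] the form [F] has [d] distinct zeros. The combination [Q] vanishes at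
    them and its terms of degree [d] cancel, so [Q = 0]; its value at [t = 0] is the identity at
    [z = x + s v]. *)
Lemma same_zeros_proportional A p x :
  (forall y, y != 0 -> ev F y = 0 <-> ev F (A *m y) = 0) -> ev F p != 0 ->
  ev F (A *m p) * ev F x = ev F p * ev F (A *m x).
Proof.
move=> hA Fp.
have [[t /eqP e]|nt] := classic (exists t, x + t *: p == 0).
  have -> : x = (- t) *: p by rewrite scaleNr; apply/eqP; rewrite -addr_eq0 e.
  by rewrite -scalemxAr !(evZ _ _ F_homog) mulrCA [RHS]mulrCA; congr (_ * _); rewrite mulrC.
have xp t : x + t *: p != 0 by apply/negP => e; apply: nt; exists t.
have [v [r rn0 hr]] := separable_lines Fp xp.
have zeros y : ev F y = 0 -> ev F (A *m y) = 0.
  by have [->|yn0] := eqVneq y 0; rewrite ?mulmx0 // => h; apply/(hA y yn0).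
have good s : r.[s] != 0 ->
    ev F (A *m p) * ev F (x + s *: v) = ev F p * ev F (A *m (x + s *: v)).
  move=> /hr; set z := x + s *: v => sep.
  pose Q := ev F (A *m p) *: line F z p - ev F p *: line F (A *m z) (A *m p).
  have [s1 c1] := line_top z p F_homog.
  have [s2 c2] := line_top (A *m z) (A *m p) F_homog.
  have sQ : (size Q <= d)%N.
    apply/leq_sizeP => j; rewrite leq_eqVlt => /orP[/eqP <-|lt].
      by rewrite coefB !coefZ c1 c2 mulrC subrr.
    by rewrite coefB !coefZ (nth_default 0 (leq_trans s1 lt)) (nth_default 0 (leq_trans s2 lt)) !mulr0 subrr.
  suff Q0 : Q = 0.
    have := congr1 (horner^~ 0) Q0; rewrite !hornerE !line_horner !scale0r !addr0.
    by move/eqP; rewrite subr_eq0 => /eqP.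
  have [rs ers] := closed_field_poly_normal (line F z p).
  have ln0 : line F z p != 0 by apply: separable_poly_neq0.
  have lcn0 : lead_coef (line F z p) != 0 by rewrite lead_coef_eq0.
  apply: (@roots_geq_poly_eq0 _ _ rs).
  - apply/allP => t trs; rewrite rootE hornerD hornerN !hornerZ !line_horner scalemxAr -mulmxDr.
    have : root (line F z p) t by rewrite ers rootZ // root_prod_XsubC.
    rewrite rootE line_horner => /eqP e.
    by rewrite e (zeros _ e) !mulr0 oppr0 addr0.
  - rewrite -separable_prod_XsubC; move: sep; rewrite {1}ers.
    by rewrite (eqp_separable (eqp_scale _ lcn0)).
  - apply: leq_trans sQ _.
    have := size_prod_XsubC rs id; rewrite -(size_scale _ lcn0) -ers => e.
    rewrite -ltnS -e ltnNge; apply/negP => /(nth_default 0) /eqP.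
    by rewrite c1 (negbTE Fp).
(* The identity holds wherever [r] does not vanish, so [r T = 0], and it extends to [s = 0]. *)
pose T := ev F (A *m p) *: line F x v - ev F p *: line F (A *m x) (A *m v).
have T0 : T = 0.
  apply/eqP; have : r * T == 0.
    apply/eqP/poly_ext => s; rewrite hornerM horner0.
    have [->|ne] := eqVneq r.[s] 0; first by rewrite mul0r.
    by rewrite !hornerE !line_horner scalemxAr -mulmxDr (good s ne) subrr mulr0.
  by rewrite mulf_eq0 (negbTE rn0).
have := congr1 (horner^~ 0) T0; rewrite !hornerE !line_horner !scale0r !addr0.
by move/eqP; rewrite subr_eq0 => /eqP.
Qed.

Lemma nonvanishing_point : (0 < n)%N -> exists p, ev F p != 0.
Proof.
move=> n0; apply: NNPP => h.
have z x : ev F x = 0 by apply/eqP; apply: contra_notT h; exists x.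
have /negP[] : grad F (const_mx 1) != 0.
  apply: F_smooth; apply/eqP => /matrixP/(_ (Ordinal n0) 0); rewrite !mxE => /eqP.
  by rewrite oner_eq0.
apply/eqP/rowP => i; rewrite [RHS]mxE.
have := line_deriv0 F (const_mx 1) (delta_mx i 0); rewrite -colE !mxE => <-.
by rewrite (_ : line _ _ _ = 0) ?deriv0 ?horner0 //; apply: poly_ext => t; rewrite line_horner z horner0.
Qed.

Theorem same_zeros_scale A : (0 < n)%N ->
  (forall y, y != 0 -> ev F y = 0 <-> ev F (A *m y) = 0) ->
  exists2 c, c != 0 & forall x, ev F (A *m x) = c * ev F x.
Proof.
move=> n0 hA; have [p Fp] := nonvanishing_point n0.
have pn0 : p != 0 by apply: contra Fp => /eqP ->; rewrite ev0.
exists (ev F (A *m p) / ev F p) => [|x].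
  by rewrite mulf_neq0 ?invr_eq0 //; apply: contra Fp => /eqP /(hA p pn0) ->.
by rewrite mulrAC (same_zeros_proportional x hA Fp) mulrAC divff // mul1r.
Qed.

End Preserving.

(** * Matrices of finite order *)

(** The polynomial [X] choose [j]; it makes the entries of [(1 + N) ^+ s], for [N] nilpotent,
    polynomial in [s]. *)
Fixpoint binomial_poly (K : numFieldType) j : {poly K} :=
  if j is i.+1 then (j%:R)^-1 *: (('X - i%:R%:P) * binomial_poly K i) else 1.

Lemma size_binomial_poly (K : numFieldType) j : size (binomial_poly K j) = j.+1.
Proof.
elim: j => [|j sb]; first by rewrite size_poly1.
rewrite /= size_scale ?invr_eq0 ?pnatr_eq0 // size_mul ?polyXsubC_eq0 -?size_poly_gt0 ?sb //.
by rewrite size_XsubC.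
Qed.

Lemma horner_binomial_poly (K : numFieldType) j s : (binomial_poly K j).[s%:R] = 'C(s, j)%:R.
Proof.
elim: j => [|j hb]; first by rewrite hornerC bin0.
rewrite hornerZ hornerM hb hornerXsubC.
have h : (s%:R - j%:R) * 'C(s, j)%:R = 'C(s, j.+1)%:R * j.+1%:R :> K.
  rewrite -!natrM mulnC mul_bin_left natrM; have [le|lt] := leqP j s; first by rewrite natrB.
  by rewrite (bin_small lt) !mulr0.
by rewrite h mulrC mulfK // pnatr_eq0.
Qed.

(** Each label in [C] belongs to at most one element of [P]. Going through the labels and choosing
    its element, if there is one, exhausts [P]. *)
Lemma finite_list (T : eqType) (C : finType) (P : T -> Prop) (R : T -> C -> Prop) :
  (forall x, P x -> exists c, R x c) ->
  (forall x y c, P x -> P y -> R x c -> R y c -> x = y) ->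
  exists2 L : seq T, uniq L & forall x, x \in L <-> P x.
Proof.
move=> ex inj.
suff [L uL hL] : exists2 L : seq T, uniq L &
    forall x, x \in L <-> (P x /\ exists2 c, c \in enum C & R x c).
  exists L => // x; rewrite hL; split => [[]//|Px]; split => //.
  by have [c] := ex x Px; exists c => //; rewrite mem_enum.
elim: (enum C) => [|c s [L uL hL]]; first by exists [::] => // x; split => // -[_ []].
have [[x [Px Rx nx]]|no] := classic (exists x, [/\ P x, R x c & x \notin L]); last first.
  exists L => // x; rewrite hL; split => -[Px [b]].
    by move=> bs Rb; split => //; exists b => //; rewrite inE bs orbT.
  rewrite inE => /orP[/eqP->|bs] Rb; last by split => //; exists b.
  by apply/hL; apply: contra_notT no => nL; exists x.
exists (x :: L) => [|y]; first by rewrite /= nx.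
rewrite inE; split => [/orP[/eqP->|/hL[Py [b bs Rb]]]|[Py [b]]].
- by split => //; exists c => //; rewrite mem_head.
- by split => //; exists b => //; rewrite inE bs orbT.
- rewrite inE => /orP[/eqP->|bs] Rb; first by rewrite (inj y x c) ?eqxx.
  by apply/orP; right; apply/hL; split => //; exists b.
Qed.

(** Otherwise a row outside the span could always be added, and the rank would exceed [N]. *)
Lemma spanning_rows (K : fieldType) N (P : 'rV[K]_N -> Prop) :
  exists r, exists2 B : 'M[K]_(r, N), (forall i, P (row i B)) & forall u, P u -> (u <= B)%MS.
Proof.
apply: NNPP => no.
suff [r [B _]] : exists r, exists2 B : 'M[K]_(r, N), (forall i, P (row i B)) & (N.+1 <= \rank B)%N.
  by rewrite leqNgt ltnS rank_leq_col.
elim: N.+1 => [|k [r [B hB rk]]]; first by exists 0%N, 0 => //; case.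
have [u Pu nu] : exists2 u, P u & ~~ (u <= B)%MS.
  apply: NNPP => h; apply: no; exists r, B => // u Pu; apply: contra_notT h => nu.
  by exists u.
exists (1 + r)%N, (col_mx u B).
  move=> i; case: (split_ordP i) => j ->; last by rewrite rowKd.
  by rewrite rowKu; have -> : row j u = u by apply/rowP => l; rewrite mxE ord1.
apply: leq_ltn_trans rk _; apply: rank_ltmx => /=.
rewrite ltmxE -{1}addsmxE addsmxSr /=; apply: contra nu => h.
by apply: submx_trans h; rewrite -addsmxE addsmxSl.
Qed.

Lemma unity_roots (K : numClosedFieldType) N : (0 < N)%N ->
  exists rs : seq K, [/\ uniq rs, size rs = N & 'X^N - 1 = \prod_(z <- rs) ('X - z%:P)].
Proof.
move=> N0; have [rs ers] := closed_field_poly_normal ('X^N - 1 : {poly K}).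
rewrite (monicP (monicXnsubC 1 N0)) scale1r in ers.
exists rs; split => //; last first.
  apply: succn_inj; rewrite -(size_prod_XsubC rs id) -ers -polyC1.
  by rewrite size_XnsubC.
rewrite -separable_prod_XsubC -ers separable_poly.unlock; apply/Bezout_eq1_coprimepP.
(* Bezout relation [- (X^N - 1) + (X / N) (N X^(N-1)) = 1]. *)
exists (-1, (N%:R)^-1 *: 'X) => /=.
rewrite derivB derivC subr0 derivXn mulN1r opprB -scalerAl mulrnAr -exprS prednK //.
by rewrite -scalerMnr -scaler_nat scalerA mulfV ?pnatr_eq0 -?lt0n // scale1r subrK.
Qed.

(** The minimal polynomial divides [X^N - 1], which has distinct roots. *)
Lemma finite_order_diag (K : numClosedFieldType) n N (A : 'M[K]_n.+1) :
  (0 < N)%N -> A ^+ N = 1 ->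
  exists D : 'rV[K]_n.+1, exists2 P, P \in unitmx & A = invmx P *m diag_mx D *m P.
Proof.
move=> N0 AN; have [rs [urs _ ers]] := unity_roots K N0.
have /diagonalizableP : exists2 rs, uniq rs & mxminpoly A %| \prod_(x <- rs) ('X - x%:P).
  exists rs => //.
  by rewrite -ers; apply: mxminpoly_min; rewrite rmorphB rmorphXn rmorph1 /= horner_mx_X AN subrr.
case=> P uP /(diagonalizable_forLR uP)[D eA].
by exists D, P => //; rewrite eA mxpoly.conjVmx.
Qed.

Lemma conj_diag_exp (K : fieldType) n N (D : 'rV[K]_n.+1) P : P \in unitmx ->
  (invmx P *m diag_mx D *m P) ^+ N = invmx P *m diag_mx (\row_i D 0 i ^+ N) *m P.
Proof.
move=> uP; elim: N => [|N IH].
  rewrite expr0 (_ : diag_mx _ = 1%:M) ?mulmx1 ?mulVmx //.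
  by apply/matrixP => i j; rewrite !mxE expr0.
rewrite exprS IH /GRing.mul /= !mulmxA mulmxK // -[X in X *m P = _]mulmxA.
congr (_ *m _ *m _); rewrite mulmx_diag; congr diag_mx.
by apply/rowP => i; rewrite !mxE exprS.
Qed.

Lemma finite_order_spectrum (K : fieldType) n N (D : 'rV[K]_n.+1) P i : P \in unitmx ->
  (invmx P *m diag_mx D *m P) ^+ N = 1 -> D 0 i ^+ N = 1.
Proof.
move=> uP; rewrite conj_diag_exp // => /(congr1 (fun B => P *m B *m invmx P)).
rewrite !mulmxA mulmxV // mul1mx -mulmxA mulmxV // !mulmx1 mulmxV //.
by move/matrixP/(_ i i); rewrite !mxE eqxx.
Qed.

Lemma conj_diag_trace (K : fieldType) n (D : 'rV[K]_n) P : P \in unitmx ->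
  \tr (invmx P *m diag_mx D *m P) = \sum_i D 0 i.
Proof. by move=> uP; rewrite mxtrace_mulC mulmxA mulmxV // mul1mx mxtrace_diag. Qed.

(** The eigenvalues have modulus 1, so [n.+1] of them add up to [n.+1] only if all are 1; and [A] is
    diagonalizable. *)
Lemma trace_max (K : numClosedFieldType) n N (A : 'M[K]_n.+1) :
  (0 < N)%N -> A ^+ N = 1 -> \tr A = n.+1%:R -> A = 1.
Proof.
move=> N0 AN; have [D [P uP eA]] := finite_order_diag N0 AN.
rewrite eA in AN *; rewrite conj_diag_trace // => e.
have norm1 i : `|D 0 i| = 1.
  apply/eqP; rewrite -(@pexpr_eq1 _ _ N) // -normrX.
  by rewrite (finite_order_spectrum _ uP AN) normr1.
have D1 i : D 0 i = 1.
  apply: (@normC_sum_upper _ _ xpredT (D 0) (fun=> 1)) => //; first by move=> j _; rewrite norm1.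
  by rewrite e sumr_const card_ord.
rewrite (_ : diag_mx D = 1%:M) ?mulmx1 ?mulVmx //.
by apply/matrixP => i j; rewrite !mxE D1.
Qed.

(** * The stabilizer of a smooth form *)

Lemma nilpotent_index (R : nzRingType) (N : R) k : N != 0 -> N ^+ k = 0 ->
  exists2 j, N ^+ j.+1 != 0 & N ^+ j.+2 = 0.
Proof.
move=> N0; elim: k => [|k IH] hk; first by move/eqP: hk; rewrite expr0 oner_eq0.
have [/IH//|Nk] := eqVneq (N ^+ k) 0.
case: k hk Nk {IH} => [|k] hk Nk; first by rewrite expr1 in hk; rewrite hk eqxx in N0.
by exists k.
Qed.

Lemma unipotent_exp (R : nzRingType) (N : R) k s : N ^+ k = 0 ->
  (1 + N) ^+ s = \sum_(j < k) N ^+ j *+ 'C(s, j).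
Proof.
move=> Nk; rewrite exprDn_comm; last exact: commr_sym (commr1 N).
under eq_bigr do rewrite expr1n mul1r.
have zero j : (k <= j)%N -> N ^+ j = 0 by move/subnKC <-; rewrite exprD Nk mul0r.
have [le|lt] := leqP s.+1 k.
  rewrite (big_ord_widen _ (fun j => N ^+ j *+ 'C(s, j)) le) big_mkcond /=.
  by apply: eq_bigr => j _; case: ltnP => // h; rewrite bin_small ?mulr0n.
rewrite (big_ord_widen _ (fun j => N ^+ j *+ 'C(s, j)) (ltnW lt)) [RHS]big_mkcond /=.
by apply: eq_bigr => j _; case: ltnP => // h; rewrite zero ?mul0rn.
Qed.

Lemma trmx_eigenvector (K : fieldType) n (A : 'M[K]_n) a :
  root (char_poly A) a -> exists2 x : 'cV[K]_n, x != 0 & A *m x = a *: x.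
Proof.
move=> ra; have : eigenvalue A^T a.
  rewrite eigenvalue_root_char /char_poly -det_tr.
  rewrite (_ : (char_poly_mx A^T)^T = char_poly_mx A) //.
  by apply/matrixP => i j; rewrite !mxE eq_sym.
case/eigenvalueP => v ev vn0; exists v^T; first by rewrite -trmx0 (inj_eq trmx_inj).
by rewrite -[A]trmxK -trmx_mul ev linearZ.
Qed.

Section Stabilizer.
Variables (n e : nat) (K : numClosedFieldType) (F : {mpoly K[n.+1]}).
Hypotheses (e_gt1 : (1 < e)%N) (F_homog : F \is e.+1.-homog).
Hypothesis F_smooth : forall x : 'cV[K]_n.+1, x != 0 -> grad F x != 0.
Implicit Types (x v : 'cV[K]_n.+1) (A B : 'M[K]_n.+1).

Definition stab A := forall x, ev F (A *m x) = ev F x.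

Lemma stab1 : stab 1.
Proof. by move=> x; rewrite mul1mx. Qed.

Lemma stabM A B : stab A -> stab B -> stab (A * B).
Proof. by move=> hA hB x; rewrite -mulmxA hA hB. Qed.

Lemma stabX A k : stab A -> stab (A ^+ k).
Proof.
by move=> hA; elim: k => [|k IH]; [rewrite expr0; apply: stab1 | rewrite exprS; apply: stabM].
Qed.

(** The gradient is homogeneous of degree [e], so the chain rule at an eigenvector [x] makes
    [grad F x] a left eigenvector of [A] for [a^-e]. *)
Lemma grad_eigen A x a : stab A -> A *m x = a *: x -> a ^+ e *: (grad F x *m A) = grad F x.
Proof.
by move=> hA eA; have := chain_rule x hA; rewrite eA (gradZ _ _ F_homog) -scalemxAl.
Qed.

Lemma eigen_neq0 A x a : stab A -> x != 0 -> A *m x = a *: x -> a != 0.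
Proof.
move=> hA xn0 eA; apply: contra (F_smooth xn0) => /eqP a0.
by rewrite -(grad_eigen hA eA) a0 expr0n -[e]prednK ?(ltnW e_gt1) // scale0r.
Qed.

Lemma stab_unit A : stab A -> A \in unitmx.
Proof.
move=> hA; rewrite unitmxE unitfE; apply/negP => /eqP det0.
have : root (char_poly A) 0.
  by rewrite rootE horner_coef0 char_poly_det det0 mulr0.
by case/trmx_eigenvector => x xn0 eA; have := eigen_neq0 hA xn0 eA; rewrite eqxx.
Qed.

Lemma stabV A : stab A -> stab (invmx A).
Proof. by move=> hA x; rewrite -hA mulmxA mulmxV ?mul1mx // stab_unit. Qed.

Lemma eigenvalue_pow A a : stab A -> root (char_poly A) a -> root (char_poly A) (a^-1 ^+ e).
Proof.
move=> hA /trmx_eigenvector[x xn0 eA].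
have an0 := eigen_neq0 hA xn0 eA.
rewrite -eigenvalue_root_char; apply/eigenvalueP; exists (grad F x); last exact: F_smooth.
by rewrite -{2}(grad_eigen hA eA) scalerA -exprMn mulVf // expr1n scale1r.
Qed.

Let a_ i : int := (- e%:Z) ^+ i.
(** An eigenvalue [a] will satisfy [a ^ a_ i = a ^ a_ j] for some [i < j < n.+2]; the product is a
    multiple of every such [a_ i - a_ j], hence a common exponent. *)
Definition stab_exponent : nat :=
  (\prod_(i < n.+2) \prod_(j < n.+2 | i < j) absz (a_ i - a_ j))%N.

Lemma a_inj i j : a_ i = a_ j -> i = j.
Proof.
move/(congr1 absz); rewrite !abszX abszN => /eqP; rewrite eqn_exp2l //.
by move/eqP.
Qed.

Lemma stab_exponent_gt0 : (0 < stab_exponent)%N.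
Proof.
apply: prodn_gt0 => i; rewrite prodn_cond_gt0 // => j ij.
by rewrite absz_gt0 subr_eq0; apply: contraL ij => /eqP /a_inj ->; rewrite ltnn.
Qed.

(** The [n.+2] numbers [a ^ a_ i] are roots of the characteristic polynomial, which has degree
    [n.+1], so two of them coincide. *)
Lemma eigenvalue_unity A a : stab A -> root (char_poly A) a -> a ^+ stab_exponent = 1.
Proof.
move=> hA ra.
have an0 : a != 0 by have [x xn0 eA] := trmx_eigenvector ra; apply: eigen_neq0 eA.
have rts i : root (char_poly A) (a ^ a_ i).
  elim: i => [|i IH]; first by rewrite /a_ expr0 expr1z.
  have := eigenvalue_pow hA IH.
  suff -> : (a ^ a_ i)^-1 ^+ e = a ^ a_ i.+1 by [].
  by rewrite /a_ exprSr -exprz_exp -invr_expz exprVn.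
have : ~~ uniq [seq a ^ a_ i | i <- iota 0 n.+2].
  apply/negP => u.
  have := max_poly_roots (monic_neq0 (char_poly_monic A)) _ u.
  rewrite size_map size_iota size_char_poly ltnn => /(_ _)/notF[].
  by apply/allP => _ /mapP[i _ ->].
case/(uniqPn 0) => i [j []]; rewrite size_map size_iota => ij jn.
have iN := ltn_trans ij jn.
rewrite !(nth_map 0%N) ?size_iota // !nth_iota // !add0n => eij.
have h : a ^+ absz (a_ i - a_ j) = 1.
  have : a ^ (a_ i - a_ j) = 1.
    by rewrite expfzDr // eij -expfzDr // subrr expr0z.
  case: (a_ i - a_ j) => k //; rewrite NegzE -invr_expz => /(congr1 GRing.inv).
  by rewrite invrK invr1.
rewrite /stab_exponent (bigD1 (Ordinal iN)) //= (bigD1 (Ordinal jn)) //=.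
by rewrite !exprM h !expr1n.
Qed.

(** Write [A = 1 + N] with [N^(j+1) x != 0] and [N^(j+2) = 0]. Both sides of
    [grad F (A^s x) = grad F x A^-s] are polynomial in [s]. In degree [(j+1) e] the coefficient is
    on the left a nonzero multiple of [grad F (N^(j+1) x)], and on the right zero, because [e > 1].
    This contradicts smoothness. *)
Lemma stab_unipotent A k : stab A -> (A - 1) ^+ k = 0 -> A = 1.
Proof.
move=> hA Nk; apply/eqP; rewrite -subr_eq0; apply/negP => /negP Nn0.
have [j Nj Nj1] := nilpotent_index Nn0 Nk.
set N := A - 1 in Nn0 Nj Nj1 Nk.
have uA := stab_unit hA.
(* [A^-1 = 1 + N'], and [N'^(j+2) = 0] because [A^-1] commutes with [N]. *)
pose N' := - (invmx A * N).
have comm : GRing.comm (invmx A) N.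
  by rewrite /N; apply: commrB; [rewrite /GRing.comm /GRing.mul /= mulmxV ?mulVmx | apply: commr1].
have eV : invmx A = 1 + N'.
  by rewrite /N' /N mulrBr mulr1 opprB addrCA /GRing.mul /= mulVmx // subrr addr0.
have N'j : N' ^+ j.+2 = 0 by rewrite /N' exprNn exprMn_comm // Nj1 !mulr0.
have [x hx] : exists x : 'cV[K]_n.+1, N ^+ j.+1 *m x != 0.
  apply: NNPP => h; case/eqP: Nj; apply/matrixP => r c.
  have : N ^+ j.+1 *m delta_mx c 0 == 0 :> 'cV[K]_n.+1.
    by apply/negPn/negP => hN; apply: h; exists (delta_mx c 0).
  by rewrite -colE => /eqP/matrixP/(_ r 0); rewrite !mxE.
case/eqP: (F_smooth hx); apply/rowP => i; rewrite !mxE.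
pose b := binomial_poly K.
have Ddh : F^`M(i) \is e.-homog by apply: dhomog_mderiv F_homog.
pose h k : {poly K} := \sum_(l < j.+2) (N ^+ l *m x) k 0 *: b l.
pose R : {poly K} := \sum_(l < j.+2) (grad F x *m N' ^+ l) 0 i *: b l.
have szh (c : 'I_j.+2 -> K) : (size (\sum_(l < j.+2) c l *: b l)%R <= j.+2)%N.
  apply: (leq_trans (size_sum _ _ _)); apply/bigmax_leqP => l _.
  by apply: (leq_trans (size_scale_leq _ _)); rewrite /b size_binomial_poly; apply: ltn_ord.
have [_ top] := @mmap_top _ K K idfun e j.+1 F^`M(i) h Ddh (fun k => szh _).
have eQ : mmap (polyC \o idfun) h F^`M(i) = R.
  apply: poly_ext_nat => s.
  have -> : R.[s%:R] = grad F (A ^+ s *m x) 0 i.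
    have hB := stabX s (stabV hA).
    have inv : invmx A ^+ s *m (A ^+ s *m x) = x.
      rewrite mulmxA (_ : _ *m _ = (invmx A * A) ^+ s).
        by rewrite [invmx A * A]mulVmx // expr1n mul1mx.
      rewrite exprMn_comm // /GRing.comm /GRing.mul /= mulmxV ?mulVmx //.
    have := chain_rule (A ^+ s *m x) hB; rewrite inv => <-.
    rewrite eV (unipotent_exp s N'j) mulmx_sumr summxE /R horner_sum.
    apply: eq_bigr => l _; rewrite hornerZ horner_binomial_poly.
    by rewrite -scaler_nat -scalemxAr [RHS]mxE mulrC.
  rewrite mxE /ev -/(horner_eval s%:R _) rmorph_mmap /meval /mmap.
  apply: eq_bigr => mm _; congr (_ * _); first by rewrite /= /horner_eval hornerC.
  apply: eq_bigr => l _ /=; congr (_ ^+ _).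
  have eA : A = 1 + N by rewrite addrC subrK.
  rewrite /horner_eval horner_sum [in RHS]eA (unipotent_exp s Nj1) mulmx_suml summxE.
  apply: eq_bigr => l' _; rewrite hornerZ horner_binomial_poly.
  by rewrite -scaler_nat -scalemxAl [RHS]mxE mulrC.
have : (mmap (polyC \o idfun) h F^`M(i))`_(j.+1 * e) = 0.
  rewrite eQ nth_default // (leq_trans (szh _)) //; move: e_gt1; nia.
rewrite top => /eqP.
have -> : mmap idfun (fun k => (h k)`_j.+1) F^`M(i) = ev F^`M(i) ((b j.+1)`_j.+1 *: (N ^+ j.+1 *m x)).
  apply: meval_eq => k0; rewrite !mxE /h coef_sum big_ord_recr /= coefZ big1 ?add0r 1?mulrC ?mxE //.
  move=> l _; rewrite coefZ nth_default ?mulr0 // /b size_binomial_poly; apply: ltn_ord.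
rewrite (evZ _ _ Ddh) mulf_eq0 expf_eq0.
have -> : ((b j.+1)`_j.+1 == 0) = false.
  have := size_binomial_poly K j.+1; rewrite -/b => sb.
  rewrite (_ : _`_j.+1 = lead_coef (b j.+1)) ?lead_coef_eq0 -?size_poly_eq0 ?sb //.
  by rewrite /lead_coef sb.
by rewrite andbF => /eqP.
Qed.

(** The characteristic polynomial divides [(X^stab_exponent - 1)^(n+1)], so by Cayley-Hamilton the
    power of [A] is unipotent. *)
Lemma stab_finite_order A : stab A -> A ^+ stab_exponent = 1.
Proof.
move=> hA; apply: (@stab_unipotent _ n.+1); first exact: stabX.
have [rs ers] := closed_field_poly_normal (char_poly A).
rewrite (monicP (char_poly_monic A)) scale1r in ers.
have srs : size rs = n.+1.
  by apply: succn_inj; rewrite -(size_prod_XsubC rs id) -ers size_char_poly.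
have dv : char_poly A %| ('X^stab_exponent - 1) ^+ n.+1.
  rewrite ers -srs.
  have : {in rs, forall z, z ^+ stab_exponent = 1}.
    by move=> z zrs; apply: (eigenvalue_unity hA); rewrite ers root_prod_XsubC.
  elim: (rs) => [|z r IH] h; first by rewrite big_nil dvd1p.
  rewrite big_cons exprS dvdp_mul //.
    by rewrite dvdp_XsubCl rootE !hornerE h ?mem_head // subrr.
  by apply: IH => w wr; apply: h; rewrite inE wr orbT.
case/dvdpP: dv => q /(congr1 (horner_mx A)).
rewrite rmorphM /= Cayley_Hamilton mulr0 rmorphXn rmorphB rmorphXn rmorph1 /= horner_mx_X.
by [].
Qed.

(** Otherwise the coordinates of [P x] outside the eigenvalue [z], together with the coordinates of
    [grad F x] in the left eigenbasis for [z^-e], are fewer than [n.+1] forms. A common zero [x] is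
    an eigenvector for [z], so [grad F x] satisfies the eigenvector equation for [z^-e]; its
    remaining coordinates then vanish too, against smoothness. *)
Lemma stab_multiplicity A (D : 'rV[K]_n.+1) P z : stab A -> P \in unitmx ->
  A = invmx P *m diag_mx D *m P ->
  (#|[pred i | (D 0 i == z)%R]| <= #|[pred i | (D 0 i == z^-1 ^+ e)%R]|)%N.
Proof.
move=> hA uP eA; rewrite leqNgt; apply/negP => lt.
pose T1 := {i | D 0 i != z}; pose T2 := {i | D 0 i == z^-1 ^+ e}.
pose g (t : T1 + T2) : {mpoly K[n.+1]} := match t with
  | inl i => \sum_j P (val i) j *: 'X_j
  | inr i => \sum_j invmx P j (val i) *: F^`M(j) end.
pose dg (t : T1 + T2) : nat := if t is inl _ then 1%N else e.
have card_lt : (#|{: T1 + T2}| < n.+1)%N.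
  rewrite card_sum !card_sig.
  have := cardC [pred i | D 0 i == z]; rewrite card_ord.
  rewrite (_ : #|[predC _]| = #|[pred i | D 0 i != z]|); last by apply: eq_card => i; rewrite !inE.
  by move=> eN; rewrite -[ltnRHS]eN addnC ltn_add2r.
have [||y [i0 yi0] hy] := @forms_common_zero _ _ K (fun i => g (enum_val i))
  (fun i => dg (enum_val i)) _ _ card_lt.
- move=> i; case: (enum_val i) => k /=; apply: rpred_sum => j _; apply: rpredZ.
    by rewrite dhomogX /= mdeg1.
  exact: dhomog_mderiv F_homog.
- by move=> i; case: (enum_val i) => k //=; apply: ltnW.
pose x : 'cV[K]_n.+1 := \col_i y i.
have xn0 : x != 0 by apply/eqP => /matrixP/(_ i0 0); rewrite !mxE => /eqP; apply/negP.
have yx : y =1 (fun i => x i 0) by move=> i; rewrite mxE.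
have hg t : (g t).@[fun i => x i 0] = 0.
  by have := hy (enum_rank t); rewrite enum_rankK (meval_eq _ yx).
have Px i : D 0 i != z -> (P *m x) i 0 = 0.
  move=> h; have := hg (inl (exist _ i h)); rewrite /= raddf_sum /= => e0.
  by rewrite mxE -[RHS]e0; apply: eq_bigr => j _; rewrite mevalZ mevalXU.
have Ax : A *m x = z *: x.
  have -> : x = invmx P *m (P *m x) by rewrite mulmxA mulVmx // mul1mx.
  rewrite eA -!mulmxA (mulmxA P (invmx P)) mulmxV // mul1mx scalemxAr; congr (_ *m _).
  rewrite mul_diag_mx; apply/colP => i; rewrite !mxE.
  have [->//|ne] := eqVneq (D 0 i) z.
  by have := Px i ne; rewrite mxE => ->; rewrite !mulr0.
have zn0 := eigen_neq0 hA xn0 Ax.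
pose w := grad F x *m invmx P.
have ew : w *m diag_mx D = z^-1 ^+ e *: w.
  have <- : grad F x *m A *m invmx P = w *m diag_mx D.
    by rewrite eA /w !mulmxA -[LHS]mulmxA mulmxV // mulmx1.
  by rewrite /w -{2}(grad_eigen hA Ax) -scalemxAl scalerA -exprMn mulVf // expr1n scale1r.
have w0 : w = 0.
  apply/rowP => i; rewrite [RHS]mxE; have [eq|ne] := eqVneq (D 0 i) (z^-1 ^+ e).
    have := hg (inr (exist _ i (introT eqP eq))); rewrite /= raddf_sum /= => e0.
    by rewrite mxE -[RHS]e0; apply: eq_bigr => j _; rewrite mevalZ mxE mulrC.
  have /rowP/(_ i) := ew; rewrite mul_mx_diag !mxE => /eqP.
  by rewrite mulrC -subr_eq0 -mulrBl mulf_eq0 subr_eq0 (negbTE ne) /= => /eqP.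
case/eqP: (F_smooth xn0).
by rewrite -[LHS]mulmx1 -(mulVmx uP) mulmxA -/w w0 mul0mx.
Qed.

(* The traces of the elements of the stabilizer take finitely many values, and [A] is
   determined by its traces against a basis of the span of the stabilizer: if
   [tr (A C) = tr (A' C)] for [C = A'^-1] then [A A'^-1] has finite order and maximal trace. *)
Lemma stab_finite : exists2 L : seq 'M[K]_n.+1, uniq L & forall A, A \in L <-> stab A.
Proof.
have [rs [_ _ ers]] := unity_roots K stab_exponent_gt0.
(* The trace is recorded by the positions of the eigenvalues among the roots of unity, which makes
   the type of labels finite. *)
have trv A : stab A -> exists s : {ffun 'I_n.+1 -> 'I_(size rs)}, \tr A = \sum_i rs`_(s i).
  move=> hA; have AN := stab_finite_order hA.
  have [D [P uP eA]] := finite_order_diag stab_exponent_gt0 AN.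
  have Drs i : D 0 i \in rs.
    rewrite -root_prod_XsubC -ers rootE !hornerE.
    by rewrite eA in AN; rewrite (finite_order_spectrum _ uP AN) subrr.
  exists [ffun i => Ordinal (etrans (index_mem _ _) (Drs i))].
  rewrite eA conj_diag_trace //; apply: eq_bigr => i _.
  by rewrite ffunE /= nth_index.
have [r [B hB span]] := spanning_rows (fun u : 'rV[K]_(n.+1 * n.+1) => stab (vec_mx u)).
pose G i := vec_mx (row i B).
apply: (@finite_list _ {ffun 'I_r -> {ffun 'I_n.+1 -> 'I_(size rs)}} stab
   (fun A s => forall i, \tr (A * G i) = \sum_k rs`_(s i k))).
  move=> A hA.
  have [s hs] : exists s : 'I_r -> {ffun 'I_n.+1 -> 'I_(size rs)},
      forall i, \tr (A * G i) = \sum_k rs`_(s i k).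
    apply: (@fin_all_exists _ (fun=> {ffun 'I_n.+1 -> 'I_(size rs)})
      (fun i s => \tr (A * G i) = \sum_k rs`_(s k))) => i.
    by apply: trv; apply: stabM => //; apply: hB.
  by exists (finfun s) => i; rewrite hs; apply: eq_bigr => k _; rewrite ffunE.
move=> A A' s hA hA' hs hs'.
have same C : stab C -> \tr (A * C) = \tr (A' * C).
  move=> hC; have /submxP[c ec] : (mxvec C <= B)%MS by apply: span; rewrite mxvecK.
  have -> : C = \sum_i c 0 i *: G i.
    rewrite -(mxvecK C) ec mulmx_sum_row linear_sum.
    by apply: eq_bigr => i _; rewrite linearZ.
  rewrite !mulr_sumr !linear_sum; apply: eq_bigr => i _ /=.
  by rewrite -!scalerAr !linearZ /= hs hs'.
have uA' := stab_unit hA'.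
have e1 : A * invmx A' = 1.
  apply: (trace_max stab_exponent_gt0).
    by apply: stab_finite_order; apply: stabM => //; apply: stabV.
  by rewrite same ?[A' * invmx A']mulmxV ?mxtrace1 //; apply: stabV.
by rewrite -[A]mulmx1 -(mulVmx uA') mulmxA [A *m _]e1 mul1mx.
Qed.

End Stabilizer.

(** * Virtual characters *)

(** Factor [E = C R] through its rank; idempotence gives [R C = 1], whose trace is the rank. *)
Lemma trace_idempotent (K : fieldType) n (E : 'M[K]_n) : E *m E = E -> \tr E = (\rank E)%:R.
Proof.
move=> idE; have e := mulmx_base E.
suff h : row_base E *m col_base E = 1%:M by rewrite -{1}e mxtrace_mulC h mxtrace1.
have inj1 := @row_free_inj _ (\rank E) _ _ _ (row_base_free E).
have inj2 := @row_full_inj _ _ _ n _ (col_base_full E).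
move: (row_base E) (col_base E) e inj1 inj2 => R C e inj1 inj2.
by apply: inj1; apply: inj2; rewrite /= mul1mx !mulmxA e -mulmxA e idE.
Qed.

Section VirtualCharacters.
Variables (K : numFieldType) (gT : unitRingType) (L : seq gT).
Hypotheses (uL : uniq L) (L1 : 1 \in L) (LM : forall g h, g \in L -> h \in L -> g * h \in L).
Hypotheses (LV : forall g, g \in L -> g^-1 \in L) (LU : forall g, g \in L -> g \is a GRing.unit).

(* Possibly non-unital, so as to include [symrep], which vanishes outside one degree. *)
Definition mult_rep (T : finType) (rho : gT -> T -> T -> K) :=
  forall g h, g \in L -> h \in L ->
    forall s t, rho (g * h) s t = \sum_u rho g s u * rho h u t.

(** The matrices are indexed by any finite type [T], so that sums and products of characters use
    [T1 + T2] and [T1 * T2]. *)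
Definition is_char (f : gT -> K) := exists T : finType, exists2 rho : gT -> T -> T -> K,
  mult_rep rho & forall g, g \in L -> f g = \sum_t rho g t t.

Definition is_vchar (f : gT -> K) := exists f1, exists f2,
  [/\ is_char f1, is_char f2 & forall g, g \in L -> f g = f1 g - f2 g].

Lemma char0 : is_char (fun=> 0).
Proof.
exists void, (fun _ _ _ => 0) => [g h _ _ []|g _]; rewrite big1 // => -[].
Qed.

Lemma char1 : is_char (fun=> 1).
Proof.
by exists unit, (fun _ _ _ => 1) => [g h _ _ s t|g _]; rewrite (bigD1 tt) //= big1 ?addr0 ?mulr1 // => -[].
Qed.

Lemma charD f1 f2 : is_char f1 -> is_char f2 -> is_char (fun g => f1 g + f2 g).
Proof.
move=> [T1 [r1 m1 e1]] [T2 [r2 m2 e2]].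
exists (T1 + T2)%type, (fun g s t => match s, t with
  | inl a, inl b => r1 g a b | inr a, inr b => r2 g a b | _, _ => 0 end).
  move=> g h gL hL [a|a] [b|b]; rewrite big_sumType /=.
  - by rewrite m1 // [X in _ + X]big1 ?addr0 // => u _; rewrite mul0r.
  - by rewrite !big1 ?addr0 // => u _; rewrite ?mul0r ?mulr0.
  - by rewrite !big1 ?addr0 // => u _; rewrite ?mul0r ?mulr0.
  - by rewrite m2 // [X in X + _]big1 ?add0r // => u _; rewrite mul0r.
by move=> g gL; rewrite big_sumType /= e1 // e2.
Qed.

Lemma charM f1 f2 : is_char f1 -> is_char f2 -> is_char (fun g => f1 g * f2 g).
Proof.
move=> [T1 [r1 m1 e1]] [T2 [r2 m2 e2]].
exists (T1 * T2)%type, (fun g s t => r1 g s.1 t.1 * r2 g s.2 t.2).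
  move=> g h gL hL [a1 a2] [b1 b2] /=; rewrite m1 // m2 // big_distrlr pair_bigA /=.
  by apply: eq_bigr => u _; ring.
move=> g gL; rewrite e1 // e2 // big_distrlr pair_bigA /=; exact: eq_bigr.
Qed.

Lemma char_dual f : is_char f -> is_char (fun g => f g^-1).
Proof.
move=> [T [r m e]]; exists T, (fun g s t => r g^-1 t s).
  move=> g h gL hL s t; rewrite invrM ?LU // m ?LV //.
  by apply: eq_bigr => u _; rewrite mulrC.
by move=> g gL; rewrite e ?LV.
Qed.

(** The average [E] of the matrices over [L] is idempotent, so its trace is its rank. *)
Lemma char_sum f : is_char f -> exists k : nat, \sum_(g <- L) f g = (size L)%:R * k%:R.
Proof.
move=> [T [r m e]].
have sn0 : (size L)%:R != 0 :> K by rewrite pnatr_eq0 size_eq0; case: L L1.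
pose M g := \matrix_(i < #|T|, j < #|T|) r g (enum_val i) (enum_val j).
have MM g h : g \in L -> h \in L -> M g *m M h = M (g * h).
  move=> gL hL; apply/matrixP => i j; rewrite !mxE m // (reindex (@enum_val T xpredT)) /=.
    by apply: eq_bigr => k _; rewrite !mxE.
  exact: onW_bij (enum_val_bij T).
have perm g : g \in L -> perm_eq [seq g * h | h <- L] L.
  move=> gL; apply: uniq_perm => //.
    by rewrite map_inj_uniq // => x y; apply: mulrI; apply: LU.
  have u' : uniq [seq g * h | h <- L] by rewrite map_inj_uniq // => x y; apply: mulrI; apply: LU.
  have sub : {subset [seq g * h | h <- L] <= L} by move=> _ /mapP[h hL ->]; apply: LM.
  by have [] := uniq_min_size u' sub; rewrite ?size_map.
pose E := (size L)%:R^-1 *: \sum_(g <- L) M g.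
have EE : E *m E = E.
  have SS : (\sum_(g <- L) M g) *m (\sum_(g <- L) M g) = (size L)%:R *: \sum_(g <- L) M g.
    rewrite mulmx_suml scaler_nat big_seq (eq_bigr (fun=> \sum_(h <- L) M h)); last first.
      move=> g gL; rewrite mulmx_sumr -[RHS](perm_big _ (perm g gL)) big_map !big_seq.
      by apply: eq_bigr => h hL; rewrite MM.
    by rewrite -big_seq big_const_seq count_predT iter_addr_0.
  by rewrite /E -scalemxAl -scalemxAr SS; congr (_ *: _); rewrite scalerA mulVf // scale1r.
exists (\rank E); rewrite -trace_idempotent // /E linearZ /= mulrA mulfV // mul1r.
rewrite linear_sum !big_seq; apply: eq_bigr => g gL /=; rewrite e //.
rewrite /mxtrace (reindex (@enum_val T xpredT)) /=; first by apply: eq_bigr => k _; rewrite mxE.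
exact: onW_bij (enum_val_bij T).
Qed.

Lemma eq_vchar f f' : (forall g, g \in L -> f g = f' g) -> is_vchar f -> is_vchar f'.
Proof. by move=> ff' [f1 [f2 [h1 h2 e]]]; exists f1, f2; split => // g gL; rewrite -ff' ?e. Qed.

Lemma char_vchar f : is_char f -> is_vchar f.
Proof. by move=> h; exists f, (fun=> 0); split => //; [exact: char0 | move=> g _; rewrite subr0]. Qed.

Lemma vcharD f1 f2 : is_vchar f1 -> is_vchar f2 -> is_vchar (fun g => f1 g + f2 g).
Proof.
move=> [a1 [b1 [ha1 hb1 e1]]] [a2 [b2 [ha2 hb2 e2]]].
exists (fun g => a1 g + a2 g), (fun g => b1 g + b2 g); split; [exact: charD..|].
by move=> g gL; rewrite e1 // e2 //; ring.
Qed.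

Lemma vcharN f : is_vchar f -> is_vchar (fun g => - f g).
Proof. by move=> [a [b [ha hb e]]]; exists b, a; split => // g gL; rewrite e // opprB. Qed.

Lemma vcharM f1 f2 : is_vchar f1 -> is_vchar f2 -> is_vchar (fun g => f1 g * f2 g).
Proof.
move=> [a1 [b1 [ha1 hb1 e1]]] [a2 [b2 [ha2 hb2 e2]]].
exists (fun g => a1 g * a2 g + b1 g * b2 g), (fun g => a1 g * b2 g + b1 g * a2 g).
split; [by apply: charD; apply: charM..|].
by move=> g gL; rewrite e1 // e2 //; ring.
Qed.

Lemma vchar_int (z : int) : is_vchar (fun=> z%:~R).
Proof.
have nat k : is_vchar (fun=> k%:R).
  elim: k => [|k IH]; first exact/char_vchar/char0.
  apply: (eq_vchar _ (vcharD (char_vchar char1) IH)) => g _; by rewrite -[in RHS]add1n natrD.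
case: z => k; first exact: nat.
by apply: (eq_vchar _ (vcharN (nat k.+1))) => g _; rewrite NegzE mulrNz.
Qed.

Lemma vchar_bigsum (I : eqType) (s : seq I) (P : pred I) (f : I -> gT -> K) :
  (forall i, is_vchar (f i)) -> is_vchar (fun g => \sum_(i <- s | P i) f i g).
Proof.
move=> h; elim: s => [|i s IH].
  by apply: (eq_vchar _ (vchar_int 0)) => g _; rewrite big_nil.
case Pi: (P i); last by apply: (eq_vchar _ IH) => g _; rewrite big_cons Pi.
by apply: (eq_vchar _ (vcharD (h i) IH)) => g _; rewrite big_cons Pi.
Qed.

Lemma vchar_bigprod (I : eqType) (s : seq I) (f : I -> gT -> K) :
  (forall i, is_vchar (f i)) -> is_vchar (fun g => \prod_(i <- s) f i g).
Proof.
move=> h; elim: s => [|i s IH].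
  by apply: (eq_vchar _ (vchar_int 1)) => g _; rewrite big_nil.
by apply: (eq_vchar _ (vcharM (h i) IH)) => g _; rewrite big_cons.
Qed.

Lemma vchar_sum f : is_vchar f -> exists k : int, \sum_(g <- L) f g = (size L)%:R * k%:~R.
Proof.
move=> [a [b [/char_sum[k hk] /char_sum[l hl] e]]]; exists (k%:Z - l%:Z).
rewrite rmorphB /= mulrBr -hk -hl -sumrB !big_seq; exact: eq_bigr.
Qed.

End VirtualCharacters.

(** * Symmetric powers *)

Section SymmetricPower.
Variables (n : nat) (K : fieldType).
Implicit Types (A B : 'M[K]_n) (p : {mpoly K[n]}).

Definition linsub A p : {mpoly K[n]} := p \mPo [tuple \sum_j A i j *: 'X_j | i < n].

Lemma linsubX A i : linsub A 'X_i = \sum_j A i j *: 'X_j.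
Proof. by rewrite /linsub comp_mpolyXU -tnth_nth tnth_mktuple. Qed.

Lemma linsub_mul A B p : linsub (A *m B) p = linsub B (linsub A p).
Proof.
elim/mpoly_ring_ind: p => [c|i|p q hp hq|p q hp hq].
- by rewrite /linsub !comp_mpolyC.
- rewrite !linsubX /linsub raddf_sum /=.
  under [RHS]eq_bigr do rewrite comp_mpolyZ -/(linsub _ _) linsubX scaler_sumr.
  rewrite exchange_big; apply: eq_bigr => k _ /=.
  by rewrite mxE scaler_suml; apply: eq_bigr => j _; rewrite scalerA.
- by move: hp hq; rewrite /linsub !comp_mpolyD => -> ->.
- by move: hp hq; rewrite /linsub !rmorphM /= => -> ->.
Qed.

Lemma linsub_homog A (mu : 'X_{1..n}) : linsub A 'X_[mu] \is (mdeg mu).-homog.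
Proof.
rewrite /linsub comp_mpolyX mdegE; elim/big_rec2: _ => [|i d p _ hp]; first exact: dhomog1.
apply: dhomogM => //; rewrite tnth_mktuple -[X in X.-homog]mul1n; apply: dhomogMn.
by apply: rpred_sum => j _; apply: rpredZ; rewrite dhomogX /= mdeg1.
Qed.

(** Matrix of the [l]-th symmetric power on monomials. The indices are all monomials of degree at
    most [l]; the first factor kills the rows of degree below [l]. *)
Definition symrep l A (s t : 'X_{1..n < l.+1}) : K :=
  (mdeg s == l)%:R * (linsub A 'X_[s])@_t.

Lemma symrepM l A B s t :
  symrep (A *m B) s t = \sum_(u : 'X_{1..n < l.+1}) symrep A s u * symrep B u t.
Proof.
rewrite /symrep; case: eqP => [es|_]; last by rewrite mul0r big1 // => u _; rewrite !mul0r.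
rewrite mul1r linsub_mul.
have hs := linsub_homog A s; rewrite es in hs.
rewrite {1}(@mpolywE _ _ l.+1 (linsub A 'X_[s])); last first.
  rewrite msizeE big_seq; apply/bigmax_leqP_seq => m _ hm.
  by rewrite (dhomog_mf hs hm).
rewrite /linsub (raddf_sum (comp_mpoly _)) (raddf_sum (mcoeff t)); apply: eq_bigr => u _ /=.
rewrite comp_mpolyZ mcoeffZ mul1r -!/(linsub _ _).
have [eu|ne] := eqVneq (mdeg u) l; first by rewrite mul1r.
by rewrite (dhomog_nemf_coeff hs) ?mul0r.
Qed.

(** The complete homogeneous symmetric polynomial, which is the trace of the symmetric power. *)
Definition hsym l (D : 'I_n -> K) : K :=
  \sum_(mu : 'X_{1..n < l.+1} | mdeg mu == l) \prod_i D i ^+ mu i.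

Lemma symrep_diag l (D : 'rV[K]_n) :
  \sum_(s : 'X_{1..n < l.+1}) symrep (diag_mx D) s s = hsym l (D 0).
Proof.
rewrite /hsym [RHS]big_mkcond; apply: eq_bigr => s _; rewrite /symrep.
case: eqP => _; last by rewrite mul0r.
rewrite mul1r /linsub comp_mpolyX.
have -> : \prod_(i < n) tnth [tuple \sum_j diag_mx D i0 j *: 'X_j | i0 < n] i ^+ s i
   = (\prod_i D 0 i ^+ s i) *: 'X_[s] :> {mpoly K[n]}.
  rewrite mpolyXE_id -mul_mpolyC rmorph_prod -big_split /=; apply: eq_bigr => i _.
  rewrite tnth_mktuple (bigD1 i) //= big1 ?addr0 => [|j ne].
    by rewrite mxE eqxx mulr1n exprZn /= mul_mpolyC.
  by rewrite mxE eq_sym (negbTE ne) mulr0n scale0r.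
by rewrite mcoeffZ mcoeffX eqxx mulr1.
Qed.

Lemma symrep_trace l (D : 'rV[K]_n) P : P \in unitmx ->
  \sum_(s : 'X_{1..n < l.+1}) symrep (invmx P *m diag_mx D *m P) s s = hsym l (D 0).
Proof.
move=> uP; rewrite -symrep_diag -mulmxA.
under eq_bigr do rewrite symrepM.
rewrite exchange_big; apply: eq_bigr => t _ /=.
transitivity (symrep (diag_mx D *m P *m invmx P) t t).
  by rewrite symrepM; apply: eq_bigr => s _; rewrite mulrC.
by rewrite mulmxK.
Qed.

End SymmetricPower.

(** * Generating functions of symmetric functions of the eigenvalues *)

Section GeneratingFunctions.
Variables (n : nat) (K : fieldType).
Implicit Types lam : 'I_n -> K.

(** For a matrix [A] with eigenvalues [lam] this is [det (1 - t A)], and [hpoly c] is its inverse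
    modulo [t^(c+1)]. *)
Definition epoly lam : {poly K} := \prod_i (1 - lam i *: 'X).
Definition hpoly c lam : {poly K} := \prod_i \sum_(k < c.+1) lam i ^+ k *: 'X^k.

Lemma hpoly_coef c l lam : (l <= c)%N -> (hpoly c lam)`_l = hsym l lam.
Proof.
move=> lc; rewrite /hpoly bigA_distr_bigA /= coef_sum.
have tm (s : {ffun 'I_n -> 'I_c.+1}) : (\prod_i (lam i ^+ s i *: 'X^(s i)))`_l =
    if (\sum_i s i)%N == l then \prod_i lam i ^+ s i else 0.
  rewrite scaler_prod coefZ -(big_morph _ (exprD 'X) (expr0 'X)) coefXn eq_sym.
  by case: eqP; rewrite ?mulr1 ?mulr0.
under eq_bigr do rewrite tm.
rewrite -big_mkcond /hsym /=.
pose h (mu : 'X_{1..n < l.+1}) : {ffun 'I_n -> 'I_c.+1} := [ffun i => inord (bmnm mu i)].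
pose h' (s : {ffun 'I_n -> 'I_c.+1}) : 'X_{1..n < l.+1} := insubd (@bm0 n l) [multinom val (s i) | i < n].
have hE (mu : 'X_{1..n < l.+1}) i : val (h mu i) = bmnm mu i.
  rewrite ffunE /= inordK // (leq_ltn_trans _ (leq_trans (bmdeg mu) _)) //.
  by rewrite mdegE (bigD1 i) //= leq_addr.
rewrite (reindex_onto h h') /=; last first.
  move=> s /eqP es; apply/ffunP => i; apply: val_inj; rewrite hE /h' val_insubd.
  rewrite mdegE (eq_bigr (fun i => val (s i))) => [|k _]; last by rewrite mnmE.
  by rewrite es ltnSn mnmE.
apply: eq_big => [mu|mu _]; last by apply: eq_bigr => i _; rewrite hE.
have -> : (\sum_i h mu i)%N = mdeg mu by rewrite mdegE; apply: eq_bigr => i _; rewrite -hE.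
case: eqP => //= _; apply/eqP/val_inj; rewrite /h' val_insubd.
have -> : [multinom val (h mu i) | i < n] = bmnm mu by apply/mnmP => i; rewrite mnmE hE.
by rewrite bmdeg.
Qed.

Lemma epoly_hpoly c lam : exists g, epoly lam * hpoly c lam = 1 + 'X^(c.+1) * g.
Proof.
rewrite /epoly /hpoly -big_split /=; elim/big_rec: _ => [|i p _ [g ->]].
  by exists 0; rewrite mulr0 addr0.
have -> : (1 - lam i *: 'X) * (\sum_(k < c.+1) lam i ^+ k *: 'X^k) =
    1 - lam i ^+ c.+1 *: 'X^(c.+1).
  rewrite -[in RHS](expr1n _ c.+1) -exprZn subrXX; congr (_ * _).
  by apply: eq_bigr => k _; rewrite expr1n mul1r exprZn.
exists (g - lam i ^+ c.+1 *: (1 + 'X^(c.+1) * g)).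
by rewrite -!mul_polyC; ring.
Qed.

Lemma hsym0 lam : hsym 0 lam = 1.
Proof.
rewrite -(@hpoly_coef 0) // /hpoly big1 ?coefC // => i _.
by rewrite big_ord1 expr0 scale1r.
Qed.

(** Read the coefficient of degree [a] in [epoly * hpoly = 1]. By recursion, the coefficients of
    [epoly] become virtual characters without any construction of exterior powers. *)
Lemma epoly_rec a lam : (epoly lam)`_a =
  (a == 0)%N%:R - \sum_(j < a) (epoly lam)`_j * hsym (a - j) lam.
Proof.
have [g /polyP/(_ a)] := epoly_hpoly a lam.
rewrite coefD coefC coefXnM ltnSn addr0 coefM big_ord_recr /= subnn hpoly_coef // hsym0 mulr1.
rewrite (_ : (if a == 0%N then 1 else 0) = (a == 0%N)%:R :> K); last by case: eqP.
move=> <-; rewrite addrC -addrA (eq_bigr (fun j : 'I_a => (epoly lam)`_j * hsym (a - j) lam)).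
  by rewrite subrr addr0.
by move=> j _; rewrite hpoly_coef // leq_subr.
Qed.

Lemma epoly_top lam : (size (epoly lam) <= n.+1)%N /\ (epoly lam)`_n = \prod_i (- lam i).
Proof.
have H (s : seq 'I_n) : (size (\prod_(i <- s) (1 - lam i *: 'X))%R <= (size s).+1)%N /\
    (\prod_(i <- s) (1 - lam i *: 'X))`_(size s) = \prod_(i <- s) (- lam i).
  elim: s => [|i s [sp cp]]; rewrite ?big_nil ?big_cons /=.
    by rewrite size_poly1 coefC.
  rewrite mulrBl mul1r -scalerAl; split.
    rewrite (leq_trans (size_polyD _ _)) // geq_max (leq_trans sp) //= size_polyN.
    by rewrite (leq_trans (size_scale_leq _ _)) // (leq_trans (size_polyMleq _ _)) // size_polyX.
  by rewrite coefB coefZ coefXM /= cp (nth_default _ sp) sub0r mulNr.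
by have := H (enum 'I_n); rewrite size_enum_ord !big_enum.
Qed.

(** * The quotient of [det (1 - t^e A)] by [det (1 - t A^-1)] *)

Section Quotient.
Variables (e : nat) (lam : 'I_n -> K).
Hypotheses (e_gt0 : (0 < e)%N) (lam_neq0 : forall i, lam i != 0).
Hypothesis mult_le : forall z,
  (#|[pred i | (lam i == z)%R]| <= #|[pred i | (lam i == z^-1 ^+ e)%R]|)%N.

Let lamV i := (lam i)^-1.
Let A : {poly K} := \prod_i (1 - lam i *: 'X^e).

(** Group the linear factors of the divisor by their roots [z]. For each [i] with [lam i = z^-e] the
    factor [1 - lam i X^e] vanishes at [z], and by [mult_le] there are enough such [i]. *)
Lemma epoly_dvd : epoly lamV %| A.
Proof.
have -> : epoly lamV = (\prod_i (- lamV i)) *: \prod_i ('X - (lam i)%:P).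
  rewrite -scaler_prod; apply: eq_bigr => i _.
  by rewrite scalerBr !scaleNr opprK addrC scale_polyC mulVf.
rewrite dvdpZl; last by apply/prodf_neq0 => i _; rewrite oppr_eq0 invr_eq0.
have -> : \prod_i ('X - (lam i)%:P) =
   \prod_(z <- undup (codom lam)) ('X - z%:P) ^+ #|[pred i | lam i == z]|.
  have -> : \prod_i ('X - (lam i)%:P) = \prod_(z <- codom lam) ('X - z%:P).
    by rewrite big_map big_enum.
  rewrite -big_undup_iterop_count /=; apply: eq_bigr => z _; congr (_ ^+ _).
  by rewrite count_map cardE -size_filter enumT; congr size; apply: eq_filter.
have : uniq (undup (codom lam)) by apply: undup_uniq.
have : {in undup (codom lam), forall z, z != 0}.
  by move=> z; rewrite mem_undup => /codomP[i ->].
elim: (undup _) => [|z s IH] h /=; first by rewrite big_nil dvd1p.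
case/andP => zs us; rewrite big_cons Gauss_dvdp; last first.
  apply: coprimep_expl; elim: (s) zs => [|w r IHr]; first by rewrite big_nil coprimep1.
  rewrite inE negb_or => /andP[zw zr]; rewrite big_cons coprimepMr IHr // andbT.
  by apply: coprimep_expr; rewrite coprimep_XsubC root_XsubC eq_sym.
rewrite IH // ?andbT; last by move=> w ws; apply: h; rewrite inE ws orbT.
have zn0 : z != 0 by apply: h; rewrite mem_head.
apply: (dvdp_trans (dvdp_exp2l _ (mult_le z))).
rewrite /A (bigID (fun i => lam i == z^-1 ^+ e)) /= dvdp_mulr //.
rewrite -prodr_const (eq_bigl (fun i => lam i == z^-1 ^+ e)) //.
elim/big_rec2: _ => [|i q1 q2 /eqP ei dq]; first exact: dvdpp.
apply: dvdp_mul => //; rewrite dvdp_XsubCl rootE !hornerE ei -exprMn mulVf //.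
by rewrite expr1n subrr.
Qed.

(** Cancel [(1 - X)^k]. At 1, each eigenvalue 1 contributes [e], and any other [lam] contributes
    [(1 - lam) / (1 - lam^-1) = - lam]. The top coefficient, the product of the [- lam^-1], cancels
    the latter and leaves [(-1)^k]. *)
Lemma quotient_eval1 P : A = epoly lamV * P ->
  (epoly lamV)`_n * P.[1] = (- e%:R) ^+ #|[pred i | lam i == 1]|.
Proof.
move=> eA; set k := #|_|.
pose S := [pred i | lam i == 1].
pose U : {poly K} := \sum_(j < e) 'X^j.
have eU : 1 - 'X^e = (1 - 'X) * U.
  rewrite -[1 in LHS](expr1n _ e) subrXX; congr (_ * _).
  by apply: eq_bigr => j _; rewrite expr1n mul1r.
pose A' : {poly K} := \prod_(i | ~~ S i) (1 - lam i *: 'X^e).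
pose B' : {poly K} := \prod_(i | ~~ S i) (1 - lamV i *: 'X).
have cst (G : {poly K}) : \prod_(i | S i) G = G ^+ k by rewrite prodr_const.
have e1 : A = (1 - 'X) ^+ k * (U ^+ k * A').
  rewrite /A (bigID S) /= mulrA -exprMn -eU; congr (_ * _); rewrite -cst.
  by apply: eq_bigr => i /eqP ->; rewrite scale1r.
have e2 : epoly lamV = (1 - 'X) ^+ k * B'.
  rewrite /epoly (bigID S) /=; congr (_ * _); rewrite -cst.
  by apply: eq_bigr => i /eqP li; rewrite /lamV li invr1 scale1r.
have X1 : (1 - 'X) ^+ k != 0 :> {poly K}.
  by rewrite expf_neq0 // -opprB oppr_eq0 polyXsubC_eq0.
have key : U ^+ k * A' = B' * P by apply: (mulfI X1); rewrite -e1 eA e2 mulrA.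
have /(congr1 (horner^~ 1)) := key.
have U1 : U.[1] = e%:R.
  rewrite horner_sum (eq_bigr (fun=> 1)) ?sumr_const ?card_ord // => j _.
  by rewrite hornerXn expr1n.
have A'1 : A'.[1] = \prod_(i | ~~ S i) (1 - lam i).
  by rewrite horner_prod; apply: eq_bigr => i _; rewrite !hornerE expr1n mulr1.
have B'1 : B'.[1] = \prod_(i | ~~ S i) (1 - lamV i).
  by rewrite horner_prod; apply: eq_bigr => i _; rewrite !hornerE.
have B'n0 : B'.[1] != 0.
  rewrite B'1; apply/prodf_neq0 => i; apply: contra; rewrite subr_eq0 eq_sym /S /= /lamV.
  by move=> /eqP /(congr1 GRing.inv); rewrite invrK invr1 => ->.
have A'B' : A'.[1] = \prod_(i | ~~ S i) (- lam i) * B'.[1].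
  rewrite A'1 B'1 -big_split /=; apply: eq_bigr => i _.
  by rewrite mulrBr mulr1 mulNr opprK mulfV // addrC.
rewrite !hornerM horner_exp U1 A'B' => eP.
have {}eP : P.[1] = e%:R ^+ k * \prod_(i | ~~ S i) (- lam i).
  by apply: (mulfI B'n0); rewrite -eP mulrA mulrC.
have [_ ->] := epoly_top lamV; rewrite eP (bigID S) /=.
have -> : \prod_(i | S i) (- lamV i) = (-1) ^+ k.
  rewrite (eq_bigr (fun=> -1)) ?prodr_const // => i /eqP li; by rewrite /lamV li invr1.
have : \prod_(i | ~~ S i) (- lamV i) * \prod_(i | ~~ S i) (- lam i) = 1.
  by rewrite -big_split big1 // => i _ /=; rewrite mulrNN mulVf.
rewrite mulrCA => E; rewrite -mulrA E mulr1 -exprMn mulrC mulN1r //.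
Qed.

(** The quotient has degree at most [n e - n], so its coefficients are those of [A * hpoly] up to
    that degree, and its value at 1 is their sum. Only coefficients of [epoly] and values of [hsym]
    remain. *)
Lemma fixed_power : (- e%:R) ^+ #|[pred i | lam i == 1]| =
  (epoly lamV)`_n * \sum_(k < (n * e - n).+1) \sum_(j < k.+1)
    (if (e %| j)%N then (epoly lam)`_(j %/ e) else 0) * hsym (k - j) lamV.
Proof.
have /dvdpP[P] := epoly_dvd; rewrite mulrC => eA.
rewrite -(quotient_eval1 eA); congr (_ * _).
have [sE cE] := epoly_top lamV.
have szE : size (epoly lamV) = n.+1.
  apply/eqP; rewrite eqn_leq sE ltnNge; apply/negP => /(nth_default 0) /eqP.
  by rewrite cE prodf_seq_eq0 => /hasP[i _ /=]; rewrite oppr_eq0 invr_eq0 (negbTE (lam_neq0 i)).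
have AE : A = epoly lam \Po 'X^e.
  rewrite /A /epoly rmorph_prod /=; apply: eq_bigr => i _.
  by rewrite comp_polyB comp_polyC comp_polyZ comp_polyX.
have An0 : A != 0.
  apply/eqP => /(congr1 (horner^~ 0)); rewrite horner_prod horner0 big1 => [|i _].
    by move/eqP; rewrite oner_eq0.
  by rewrite !hornerE expr0n eqn0Ngt e_gt0 mulr0 subr0.
have sA : (size A <= (n * e).+1)%N.
  rewrite AE (leq_trans (size_comp_poly_leq _ _)) // size_polyXn /= ltnS leq_mul2r.
  by have [sl _] := epoly_top lam; apply/orP; right; case: (size _) sl.
have sP : (size P <= (n * e - n).+1)%N.
  have Pn0 : P != 0 by apply: contra An0 => /eqP P0; rewrite eA P0 mulr0.
  have En0 : epoly lamV != 0 by rewrite -size_poly_eq0 szE.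
  have := size_mul En0 Pn0; rewrite -eA szE addSn /= => h.
  by move: sA; rewrite h; move: (size P) (n * e)%N => a b; lia.
rewrite (horner_coef_wide _ sP); apply: eq_bigr => k _; rewrite expr1n mulr1.
have [g eg] := epoly_hpoly (n * e - n)%N lamV.
have -> : P`_k = (A * hpoly (n * e - n)%N lamV)`_k.
  rewrite eA mulrAC eg mulrDl mul1r coefD -mulrA coefXnM ltn_ord addr0 //.
rewrite coefM; apply: eq_bigr => j _; rewrite AE coef_comp_poly_Xn //.
by rewrite hpoly_coef // (leq_trans (leq_subr _ _)) // -ltnS.
Qed.

End Quotient.

End GeneratingFunctions.

(** * The order of the stabilizer *)

Section StabilizerOrder.
Variables (n e : nat) (K : numClosedFieldType) (F : {mpoly K[n.+1]}).
Hypotheses (e_gt1 : (1 < e)%N) (F_homog : F \is e.+1.-homog).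
Hypothesis F_smooth : forall x : 'cV[K]_n.+1, x != 0 -> grad F x != 0.
Variable L : seq 'M[K]_n.+1.
Hypotheses (uL : uniq L) (memL : forall A, A \in L <-> stab F A).

Let L1 : 1 \in L. Proof. by apply/memL; apply: stab1. Qed.
Let LM g h : g \in L -> h \in L -> g * h \in L.
Proof. by move=> /memL hg /memL hh; apply/memL; apply: stabM. Qed.
Let LU g : g \in L -> g \is a GRing.unit.
Proof. by move=> /memL hg; apply: (stab_unit e_gt1 F_homog F_smooth hg). Qed.
Let LV g : g \in L -> g^-1 \in L.
Proof. by move=> /memL hg; apply/memL; apply: (stabV e_gt1 F_homog F_smooth hg). Qed.

(** The eigenvalues in some order, chosen for each matrix; the value is unspecified on matrices that
    are not diagonalizable. *)
Definition spec (A : 'M[K]_n.+1) : 'rV[K]_n.+1 := epsilon (inhabits 0)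
  (fun D => exists2 P, P \in unitmx & A = invmx P *m diag_mx D *m P).

Lemma specP A : A \in L -> exists2 P, P \in unitmx & A = invmx P *m diag_mx (spec A) *m P.
Proof.
move=> /memL hA.
have := finite_order_diag (stab_exponent_gt0 n e_gt1)
  (stab_finite_order e_gt1 F_homog F_smooth hA).
exact: (epsilon_spec (inhabits 0)
  (fun D => exists2 P, P \in unitmx & A = invmx P *m diag_mx D *m P)).
Qed.

Lemma spec_neq0 A i : A \in L -> spec A 0 i != 0.
Proof.
move=> AL; have [P uP eA] := specP AL; have /memL hA := AL.
have := stab_finite_order e_gt1 F_homog F_smooth hA; rewrite eA => AN.
have := finite_order_spectrum i uP AN; rewrite -eA => h.
apply/eqP => s0; move/eqP: h; rewrite s0 expr0n eqn0Ngt (stab_exponent_gt0 n e_gt1) eq_sym.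
by rewrite oner_eq0.
Qed.

Lemma char_sym l : is_char L (fun A => \sum_(s : 'X_{1..n.+1 < l.+1}) symrep A s s).
Proof. by exists 'X_{1..n.+1 < l.+1}, (@symrep _ _ l) => // A B _ _ s t; apply: symrepM. Qed.

Lemma vchar_hsym l : is_vchar L (fun A => hsym l (spec A 0)).
Proof.
apply: (eq_vchar _ (char_vchar (char_sym l))) => A AL.
by have [P uP eA] := specP AL; rewrite {1}eA symrep_trace.
Qed.

Lemma vchar_hsymV l : is_vchar L (fun A => hsym l (fun i => (spec A 0 i)^-1)).
Proof.
apply: (eq_vchar _ (char_vchar (char_dual LV LU (char_sym l)))) => A AL.
have [P uP eA] := specP AL.
pose D' : 'rV[K]_n.+1 := \row_i (spec A 0 i)^-1.
have -> : A^-1 = invmx P *m diag_mx D' *m P.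
  apply: (mulrI (LU AL)); rewrite mulrV ?LU // {1}eA /GRing.mul /= !mulmxA mulmxK //.
  rewrite -[X in X *m P]mulmxA mulmx_diag (_ : diag_mx _ = 1%:M) ?mulmx1 ?mulVmx //.
  apply/matrixP => i j; rewrite !mxE; case: eqP => //= ->; rewrite mulfV //.
  exact: spec_neq0.
rewrite symrep_trace //; apply: eq_bigr => mu _; apply: eq_bigr => i _.
by rewrite mxE.
Qed.

Lemma vchar_epoly (f : 'M[K]_n.+1 -> 'I_n.+1 -> K) :
  (forall l, is_vchar L (fun A => hsym l (f A))) ->
  forall a, is_vchar L (fun A => (epoly (f A))`_a).
Proof.
move=> hf a; elim/ltn_ind: a => a IH.
have key : is_vchar L (fun A => \sum_(j < a) (epoly (f A))`_j * hsym (a - j) (f A)).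
  by apply: vchar_bigsum => j; apply: vcharM => //; apply: IH.
have := vcharD (vchar_int K L (a == 0)%N) (vcharN key).
by apply: eq_vchar => A _; rewrite [RHS]epoly_rec; case: eqP.
Qed.

Let fixdim A := #|[pred i | spec A 0 i == 1]|.

Lemma vchar_fixed : is_vchar L (fun A => (- e%:R : K) ^+ fixdim A).
Proof.
pose V (A : 'M[K]_n.+1) i := (spec A 0 i)^-1.
have key : is_vchar L (fun A => (epoly (V A))`_n.+1 *
    \sum_(k < (n.+1 * e - n.+1).+1) \sum_(j < k.+1)
      (if (e %| j)%N then (epoly (spec A 0))`_(j %/ e) else 0) * hsym (k - j) (V A)).
  apply: vcharM; first exact: vchar_epoly vchar_hsymV _.
  apply: vchar_bigsum => k; apply: vchar_bigsum => j; apply: vcharM; last exact: vchar_hsymV.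
  case: (e %| j)%N; first exact: vchar_epoly vchar_hsym _.
  exact: (vchar_int K L 0).
apply: (eq_vchar _ key) => A AL; have /memL hA := AL.
have [P uP eA] := specP AL.
rewrite -[LHS]fixed_power ?(ltnW e_gt1) //; first by move=> i; apply: spec_neq0.
by move=> z; apply: (stab_multiplicity e_gt1 F_homog F_smooth z hA uP eA).
Qed.

Lemma fixdim1 A : A \in L -> (fixdim A < n.+1)%N = (A != 1).
Proof.
move=> AL; have [P uP eA] := specP AL; apply/idP/idP.
  apply: contraTneq => A1; rewrite -leqNgt /fixdim.
  rewrite -[leqLHS](card_ord n.+1); apply/subset_leq_card/subsetP => i _; rewrite inE.
  have := @finite_order_spectrum _ _ 1 (spec A) P i uP; rewrite -eA expr1 A1 => /(_ erefl).
  by rewrite expr1 => ->; rewrite eqxx.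
apply: contraR; rewrite -leqNgt => h; apply/eqP; rewrite eA.
rewrite (_ : diag_mx _ = 1%:M) ?mulmx1 ?mulVmx //.
have full : #|[pred i | spec A 0 i == 1]| = #|'I_n.+1|.
  by apply/eqP; rewrite eqn_leq max_card card_ord.
have /subset_cardP/(_ (subset_predT _)) := full.
move=> sp; apply/matrixP => i j; rewrite !mxE.
by have := sp i; rewrite !inE => /eqP ->.
Qed.

Theorem stab_order : exists k : int,
  \prod_(j < n.+1) ((- e%:Z) ^+ n.+1 - (- e%:Z) ^+ j) = (size L)%:Z * k.
Proof.
pose Phi A := \prod_(j <- enum 'I_n.+1) ((- e%:R) ^+ fixdim A - (- e%:R) ^+ j) : K.
have : is_vchar L Phi.
  apply: vchar_bigprod => j; apply: vcharD; first exact: vchar_fixed.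
  have := vchar_int K L (- (- e%:Z) ^+ j); apply: eq_vchar => A _.
  by rewrite rmorphN rmorphXn rmorphN.
(* For [A != 1] the factor with [j = fixdim A] is zero, so the sum of [Phi] over [L] reduces to
   [Phi 1]. *)
case/(vchar_sum uL L1 LM LU) => k; rewrite (bigD1_seq 1) //= big1_seq ?addr0; last first.
  move=> A /andP[A1 AL]; rewrite -(fixdim1 AL) in A1.
  by rewrite /Phi big_enum (bigD1 (Ordinal A1)) //= subrr mul0r.
move=> e1; exists k; apply: (@intr_inj K); rewrite rmorphM /= -[RHS]e1 /Phi big_enum rmorph_prod.
have f1 : fixdim 1 = n.+1.
  by apply/eqP; rewrite eqn_leq [X in _ && X]leqNgt (fixdim1 L1) eqxx andbT -[leqRHS]card_ord max_card.
by apply: eq_bigr => j _; rewrite f1 rmorphB !rmorphXn rmorphN.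
Qed.

End StabilizerOrder.

(** * The projective group *)

(** Keep the head of the list, remove its class, which has [d] elements, and repeat. *)
Lemma transversal_list (T : eqType) (R : rel T) d (L : seq T) : uniq L ->
  {in L, reflexive R} -> {in L &, ssrbool.symmetric R} -> {in L & &, transitive R} ->
  {in L, forall x, count (R x) L = d} ->
  exists L', [/\ {subset L' <= L}, pairwise (fun x y => ~~ R x y) L',
    {in L, forall x, exists2 y, y \in L' & R x y} & size L = (d * size L')%N].
Proof.
have [N] := ubnP (size L); elim: N L => // N IH [|x s].
  by exists [::]; rewrite muln0.
set L := x :: s => sz uL rR sR tR cR.
have xL : x \in L by apply: mem_head.
pose L2 := filter (predC (R x)) L.
have sub : {subset L2 <= L} by move=> y; rewrite mem_filter => /andP[].
have [|||||y yL2|L' [sL' pL' cL' zL']] := IH L2.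
- rewrite /L2 /= rR //=; apply: leq_ltn_trans (_ : size s < N)%N => //.
  by rewrite size_filter count_size.
- exact: filter_uniq.
- by move=> y /sub; apply: rR.
- by move=> y z /sub yL /sub zL; apply: sR.
- by move=> y z w /sub yL /sub zL /sub wL; apply: tR.
- rewrite -(cR y (sub _ yL2)) count_filter; apply: eq_in_count => z zL /=.
  apply: andb_idr => Ryz; have yL := sub _ yL2; apply: contraL yL2 => Rxz.
  have Rzy : R z y by rewrite sR.
  by rewrite mem_filter /= (tR z x y zL xL yL Rxz Rzy).
exists (x :: L'); split.
- by move=> y; rewrite inE => /orP[/eqP->//|/sL' /sub].
- rewrite /= pL' andbT; apply/allP => y /sL'; rewrite mem_filter => /andP[] //.
- move=> y yL; have [Ryx|nR] := boolP (R y x); first by exists x; rewrite ?mem_head.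
  have [|z zM Ryz] := cL' y; first by rewrite mem_filter /= yL andbT sR.
  by exists z => //; rewrite inE zM orbT.
- by rewrite [size (x :: L')]/= mulnS -zL' size_filter -(cR x xL) count_predC.
Qed.

(** Up to sign, the given product is that of the [e^j a_j] for [j <= n], and [a_n = d]. In [bound],
    each lcm is [m i] times ['C(n.+1, i) * e^i], which cancels the binomial; for [i = 0] it is
    [n.+1 * e^n], which cancels [n.+1] and supplies the factor [e^n] of index [n]. *)
Lemma bound_multiple n d (s : nat) (k : int) : (1 <= n)%N -> (2 < d)%N ->
  \prod_(j < n.+1) ((- d.-1%:Z) ^+ n.+1 - (- d.-1%:Z) ^+ j) = (d * s)%N%:Z * k ->
  exists k' : int, bound n d = k'%:~R * s%:R.
Proof.
move=> n1 d2; set e := d.-1 => eP.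
pose a i : int := (-1) ^+ (n - i) + (e ^ (n - i + 1))%N%:Z.
have an : a n = d%:Z by rewrite /a subnn expr0 add0n expn1 /e; lia.
have fac j : (j <= n)%N ->
    (- e%:Z) ^+ n.+1 - (- e%:Z) ^+ j = (-1) ^+ n.+1 * (e%:Z ^+ j * a j).
  move=> jn; rewrite /a; set u := (n - j)%N.
  have -> : n.+1 = (j + u.+1)%N by rewrite addnS subnKC.
  rewrite !exprD !(exprNn e%:Z) addn1.
  have -> : (e ^ u.+1)%N%:Z = e%:Z ^+ u.+1 by rewrite -!natz natrX.
  have TT : (-1) ^+ u * (-1) ^+ u = 1 :> int by rewrite -exprMn mulrNN mulr1 expr1n.
  move: TT; rewrite [(-1) ^+ u.+1]exprS; move: ((-1) ^+ u) ((-1) ^+ j) (e%:Z ^+ j) (e%:Z ^+ u.+1).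
  move=> t x y z tt; apply/eqP; rewrite -subr_eq0.
  have -> : x * y * (-1 * t * z) - x * y - x * (-1 * t) * (y * (t + z)) = x * y * (t * t - 1).
    by ring.
  by rewrite tt subrr mulr0.
pose sg : int := (-1) ^+ n.+1 ^+ n.+1.
have sg2 : sg * sg = 1 by rewrite /sg -!exprMn mulrNN mulr1 !expr1n.
have eP2 : (\prod_(j < n) (e%:Z ^+ j * a j)) * e%:Z ^+ n * d%:Z = sg * ((d * s)%N%:Z * k).
  rewrite -eP (eq_bigr (fun j : 'I_n.+1 => (-1) ^+ n.+1 * (e%:Z ^+ j * a j))); last first.
    by move=> j _; apply: fac; rewrite -ltnS.
  rewrite [X in sg * X]big_split /= prodr_const card_ord -/sg mulrA sg2 mul1r big_ord_recr /= an.
  by rewrite mulrA.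
pose c : int := sg * k.
have eP3 : (\prod_(j < n) (e%:Z ^+ j * a j)) * e%:Z ^+ n = s%:Z * c.
  have dn0 : d%:Z != 0 by lia.
  by apply: (mulIf dn0); rewrite eP2 /c PoszM; ring.
pose m i := (lcmn ('C(n.+1, i) * e ^ i) (n.+1 * e ^ n) %/ ('C(n.+1, i) * e ^ i))%N.
pose M := (\prod_(1 <= i < n) m i)%N.
exists (c * M%:Z).
have -> : (c * M%:Z)%:~R * s%:R = ((s%:Z * c) * M%:Z)%:~R :> rat.
  by rewrite !intrM -pmulrn; ring.
rewrite -eP3 /bound.
have term i : (i < n)%N -> ('C(n.+1, i))%:R^-1 *
      ((-1) ^+ (n - i) + ((d - 1) ^ (n - i + 1))%:R) *
      (lcmn ('C(n.+1, i) * (d - 1) ^ i) (n.+1 * (d - 1) ^ n))%:R =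
    (e%:Z ^+ i * a i)%:~R * (m i)%:R :> rat.
  move=> lt; rewrite subn1 -/e.
  have Cn0 : ('C(n.+1, i))%:R != 0 :> rat.
    by rewrite pnatr_eq0 -lt0n bin_gt0 (leq_trans (ltnW lt)).
  have -> : lcmn ('C(n.+1, i) * e ^ i) (n.+1 * e ^ n) = (m i * ('C(n.+1, i) * e ^ i))%N.
    by rewrite divnK // dvdn_lcml.
  have -> : (e%:Z ^+ i * a i)%:~R =
      e%:R ^+ i * ((-1) ^+ (n - i) + (e ^ (n - i + 1))%:R) :> rat.
    by rewrite /a intrM intrD !rmorphXn rmorphN1.
  rewrite !natrM !natrX; move: Cn0; move: ('C(n.+1, i))%:R => c0 c0n0.
  by field.
rewrite big_ltn // [X in _ * (_ * X)]big_nat_cond.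
rewrite (eq_bigr (fun i => (e%:Z ^+ i * a i)%:~R * (m i)%:R)); last first.
  by move=> i /andP[/andP[_ lt] _]; apply: term.
rewrite -big_nat_cond big_split /= -(big_mkord xpredT (fun j => e%:Z ^+ j * a j)) [in RHS]big_ltn //.
rewrite bin0 subn0 expn0 mul1n lcm1n subn1 -/e expr0 mul1r.
have ea0 : (a 0)%:~R = (-1) ^+ n + (e ^ (n + 1))%:R :> rat.
  by rewrite /a subn0 intrD !rmorphXn rmorphN1.
have eM : \prod_(1 <= i < n) (m i)%:R = M%:R :> rat by rewrite natr_prod.
have eX : \prod_(1 <= i < n) (e%:Z ^+ i * a i)%:~R =
  (\prod_(1 <= i < n) (e%:Z ^+ i * a i))%:~R :> rat by rewrite rmorph_prod.
rewrite eM eX -ea0 {eM eX ea0}; move: (\prod_(1 <= i < n) _) M (a 0) => X M0 a0.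
rewrite !intrM rmorphXn /= natrM natrX invr1 mul1r.
have n0 : n.+1%:R != 0 :> rat by rewrite pnatr_eq0.
have -> : M0%:Z%:~R = M0%:R :> rat by [].
have -> : e%:Z%:~R = e%:R :> rat by [].
by move: (n.+1%:R) n0 (e%:R ^+ n) => p pn0 q; field.
Qed.

(** * From projective transformations to the stabilizer *)

Section Main.
Variables (n d : nat) (F : {mpoly CC[n.+1]}).
Hypotheses (n_gt0 : (1 <= n)%N) (d_gt2 : (2 < d)%N) (smF : smooth_hypersurface d F).
Local Notation K := CC.

Let d_def : d = d.-1.+1. Proof. by rewrite prednK // (ltn_trans _ d_gt2). Qed.
Let d_gt0 : (0 < d)%N. Proof. by apply: leq_trans d_gt2. Qed.
Let e_gt1 : (1 < d.-1)%N. Proof. by move: d_gt2; lia. Qed.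

Lemma smooth_homog : F \is d.-homog. Proof. by case: smF. Qed.

(** By Euler's relation [F] vanishes wherever its gradient does, and smoothness excludes this at
    nonzero points. *)
Lemma smooth_grad (x : 'cV[K]_n.+1) : x != 0 -> grad F x != 0.
Proof.
move=> xn0; apply/negP => /eqP g0.
have F0 : ev F x = 0.
  have := euler x smooth_homog; rewrite g0 mul0mx mxE => /esym/eqP.
  by rewrite mulf_eq0 pnatr_eq0 eqn0Ngt d_gt0 => /eqP.
case: smF => _ _ /(_ (fun i => x i 0)) [|//|i].
  have /cV0Pn[i xi] := xn0; by exists i.
by move/rowP/(_ i): g0; rewrite !mxE /ev => ->; rewrite eqxx.
Qed.

Lemma mx_act_mul A (x : 'cV[K]_n.+1) : F.@[mx_act A (fun i => x i 0)] = ev F (A *m x).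
Proof. by apply: meval_eq => i; rewrite /mx_act mxE. Qed.

Lemma preservesP A : preserves A F <->
  (forall y : 'cV[K]_n.+1, y != 0 -> ev F y = 0 <-> ev F (A *m y) = 0).
Proof.
split => [h y yn0|h x [i xi]].
  have := h (fun i => y i 0); rewrite mx_act_mul; apply.
  by have /cV0Pn[i yi] := yn0; exists i.
pose y : 'cV[K]_n.+1 := \col_i x i.
have yn0 : y != 0 by apply/cV0Pn; exists i; rewrite mxE.
have xy : x =1 (fun i => y i 0) by move=> j; rewrite mxE.
have := h y yn0; rewrite -mx_act_mul /ev (meval_eq _ xy).
rewrite (@meval_eq _ _ (mx_act A x) (mx_act A (fun i => y i 0))) // => j.
by apply: eq_bigr => l _; rewrite xy.
Qed.

Lemma stab_preserves A : stab F A -> preserves A F.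
Proof. by move=> hA; apply/preservesP => y _; rewrite hA. Qed.

(** [A] multiplies [F] by a scalar [c]; rescale it by a [d]-th root of [c^-1]. *)
Lemma preserves_stab A : preserves A F -> exists2 c, c != 0 & stab F (c *: A).
Proof.
move=> /preservesP hA.
have [c cn0 hc] := same_zeros_scale (ltnW d_gt2) smooth_homog smooth_grad (ltn0Sn n) hA.
pose mu := d.-root c^-1; have muE : mu ^+ d = c^-1 by rewrite rootCK.
exists mu.
  apply: contraNneq cn0 => mu0; rewrite -(invr_eq0 c) -muE mu0 expr0n.
  by rewrite eqn0Ngt d_gt0.
by move=> x; rewrite -scalemxAl (evZ _ _ smooth_homog) muE hc mulKf.
Qed.

Lemma stab_scale A c : stab F A -> stab F (c *: A) <-> c ^+ d = 1.
Proof.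
move=> hA; split => [h|c1 x]; last by rewrite -scalemxAl (evZ _ _ smooth_homog) c1 mul1r.
have [p Fp] := nonvanishing_point smooth_grad (ltn0Sn n).
have := h p; rewrite -scalemxAl (evZ _ _ smooth_homog) hA => e1.
by apply: (mulIf Fp); rewrite mul1r.
Qed.

End Main.

(* The group {g in PGL_{n+1}(C) | g X = X} is finite, represented by the list L
   of pairwise non-proportional invertible matrices (one per element), and its
   order size L divides bound n d. *)
Theorem theorem3 (n d : nat) (F : {mpoly CC[n.+1]}) :
  (1 <= n)%N -> (2 < d)%N -> smooth_hypersurface d F ->
  exists L : seq 'M[CC]_(n.+1),
    [/\ forall A, A \in L -> A \in unitmx /\ preserves A F,
        forall i j, (i < size L)%N -> (j < size L)%N -> i <> j ->
          ~ proportional (nth 0 L i) (nth 0 L j),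
        forall A : 'M[CC]_(n.+1), A \in unitmx -> preserves A F ->
          exists2 B, B \in L & proportional A B
      & exists k : int, bound n d = k%:~R * (size L)%:R].
Proof.
move=> n_gt0 d_gt2 smF.
have d_gt0 : (0 < d)%N by apply: leq_trans d_gt2.
have d_def : d = d.-1.+1 by rewrite prednK.
have e_gt1 : (1 < d.-1)%N by move: d_gt2; lia.
have smooth_grad := smooth_grad d_gt2 smF.
have stab_scale := stab_scale d_gt2 smF.
have hF : F \is d.-1.+1.-homog by rewrite -d_def (smooth_homog smF).
have [L uL memL] := stab_finite e_gt1 hF smooth_grad.
have [k hk] := stab_order e_gt1 hF smooth_grad uL memL.
have [rs [urs szrs ers]] := unity_roots CC d_gt0.
have rsE z : (z \in rs) = (z ^+ d == 1).
  by rewrite -root_prod_XsubC -ers rootE !hornerE subr_eq0.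
have rsn0 z : z \in rs -> z != 0.
  by rewrite rsE; apply: contraTneq => ->; rewrite expr0n eqn0Ngt d_gt0 eq_sym oner_eq0.
have rsV z : z \in rs -> z^-1 \in rs by rewrite !rsE exprVn invr_eq1.
(* Elements of the stabilizer are proportional exactly when their ratio is a [d]-th root of unity.
   The classes of [R] thus have [d] elements, and a transversal represents the projective group. *)
pose R (A B : 'M[CC]_n.+1) := has (fun z => A == z *: B) rs.
have RP A B : reflect (exists2 z, z \in rs & A = z *: B) (R A B).
  by apply: (iffP hasP) => -[z zr /eqP e1]; exists z => //; apply/eqP.
have unitL A : A \in L -> A \in unitmx.
  by move/memL => hA; apply: (stab_unit e_gt1 hF smooth_grad hA).
have symR A B : R A B -> R B A.
  move/RP => [z zr ->]; apply/RP; exists z^-1; first exact: rsV.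
  by rewrite scalerA mulVf ?rsn0 // scale1r.
have [] := @transversal_list _ R d L uL.
- move=> A AL; apply/RP; exists 1; rewrite ?scale1r // rsE expr1n //.
- by move=> A B AL BL; apply/idP/idP => /symR.
- move=> B A C BL AL CL /RP[z zr ->] /RP[w wr ->]; apply/RP; exists (z * w).
    by move: zr wr; rewrite !rsE exprMn => /eqP -> /eqP ->; rewrite mulr1.
  by rewrite scalerA.
- move=> A AL; have /memL hA := AL.
  rewrite -size_filter -szrs -(size_map (fun z => z *: A) rs).
  have An0 : A != 0.
    apply/eqP => A0; have := unitL A AL; rewrite A0 unitmxE det0 ?unitr0 //.
  apply/eqP; rewrite -uniq_size_uniq ?filter_uniq //.
    rewrite map_inj_in_uniq // => z w _ _ /eqP; rewrite -subr_eq0 -scalerBl.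
    by rewrite scaler_eq0 (negbTE An0) orbF subr_eq0 => /eqP.
  move=> B; rewrite mem_filter; apply/mapP/andP => [[z zr ->]|[/symR/RP[z zr e1] _]].
    split; first by apply: symR; apply/RP; exists z.
    by apply/memL/(stab_scale _ _ hA)/eqP; rewrite -rsE.
  by exists z.
move=> L' [sub pw cov szL]; exists L'; split.
- by move=> A /sub AL; split; [apply: unitL | apply: stab_preserves; apply/memL].
- have nprop A B : A \in L' -> B \in L' -> ~~ R A B -> ~ proportional A B.
    move=> /sub/memL hA /sub/memL hB /negP nR [c [cn0 e1]]; apply: nR; apply/RP; exists c => //.
    by rewrite rsE; apply/eqP/(stab_scale _ c hB); rewrite -e1.
  have lt_case i j : (i < j < size L')%N -> ~~ R (nth 0 L' i) (nth 0 L' j).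
    move=> /andP[ij js]; move/(pairwiseP 0): pw; apply => //.
    exact: ltn_trans js.
  move=> i j iL jL ne; apply: nprop; rewrite ?mem_nth //.
  case: (ltngtP i j) => [ij|ji|//]; first by apply: lt_case; rewrite ij.
  by apply/negP => /symR; apply/negP; apply: lt_case; rewrite ji.
- move=> A uA /(preserves_stab d_gt2 smF)[c cn0 /memL cA].
  have [B BL /RP[z zr e1]] := cov _ cA; exists B => //; exists (c^-1 * z).
  split; first by apply: mulf_neq0; [rewrite invr_eq0 | apply: rsn0].
  by rewrite -scalerA -e1 scalerA mulVf // scale1r.
- by apply: (@bound_multiple n d (size L') k) => //; rewrite -szL.
Qed.
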